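(* Let $m\ge 2$ and $k\in\{0,1,\ldots,m\}$. The variety $X_{\mathrm{deg}}(m,k)$ is smooth if and only if $k=0$, $k=m$ or $(m,k)=(2,1)$. In the first two cases, $X_{\mathrm{deg}}(m,0)$ and $X_{\mathrm{deg}}(m,m)$ are linear spaces, while $X_{\mathrm{deg}}(2,1)\simeq\mathbb{P}^1\times\mathbb{P}^1\times\mathbb{P}^1\subset\mathbb{P}^7$.
   Context: $V$ is the complex vector space of dimension $2m^2$ of pairs $(A,B)$ of complex $m\times m$ matrices; $\mathbb{P}(V)=(V\setminus\{0\})/\mathbb{C}^*$, and $[A,B]$ denotes the class of $(A,B)$. $X_{\mathrm{deg}}(m,k):=\{[A,B]\in\mathbb{P}(V) : AB^T=B^TA=0,\ \operatorname{rk}A\le k,\ \operatorname{rk}B\le m-k\}$. $\mathbb{P}^1\times\mathbb{P}^1\times\mathbb{P}^1\subset\mathbb{P}^7$ denotes the Segre embedding (for $m=2$, $\mathbb{P}(V)\simeq\mathbb{P}^7$). *)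

(* Defs.v *)
From HB Require Import structures.
From mathcomp Require Import all_boot all_order all_algebra.
From mathcomp Require Import boolp classical_sets reals.
From mathcomp Require Import complex mxtens mpoly.

Set Implicit Arguments.
Unset Strict Implicit.
Unset Printing Implicit Defensive.

Import GRing.Theory.
Local Open Scope classical_set_scope.
Local Open Scope quotient_scope.
Local Open Scope ring_scope.

Section ProjectiveSpace.
Variables (K : closedFieldType) (V : vectType K).

Definition nonzero := {v : V | v != 0}.

Definition collinear : rel nonzero :=
  fun u v => `[< exists2 c : K, c != 0 & val v = c *: val u >].

Lemma collinear_refl : reflexive collinear.
Proof. by move=> u; apply/asboolP; exists 1; rewrite ?oner_neq0 ?scale1r. Qed.

Lemma collinear_sym : ssrbool.symmetric collinear.
Proof.
suff H u v : collinear u v -> collinear v u by move=> u v; apply/idP/idP; exact: H.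
move=> /asboolP[c c0 e]; apply/asboolP; exists c^-1; first by rewrite invr_eq0.
by rewrite e scalerA mulVf ?scale1r.
Qed.

Lemma collinear_trans : transitive collinear.
Proof.
move=> v u w /asboolP[c c0 e] /asboolP[d d0 e']; apply/asboolP.
by exists (d * c); rewrite ?mulf_neq0 // e' e scalerA.
Qed.

Canonical collinear_equiv :=
  EquivRel collinear collinear_refl collinear_sym collinear_trans.

Definition projspace := {eq_quot collinear_equiv}.

Definition pt (u : nonzero) : projspace := \pi_projspace u.
Definition rep (x : projspace) : V := val (repr x).

(* [projset S] is the set of the classes of the nonzero vectors of [S]. *)
Definition projset (S : set V) : set projspace :=
  [set pt u | u in [set u : nonzero | S (val u)]].

Definition linear_space (X : set projspace) : Prop :=
  exists W : {vspace V}, X = projset [set v | v \in W].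

(* Polynomial functions on [V] are read in the coordinates of the library's
   basis of [V]; none of the notions below depends on this basis. *)
Definition coords (v : V) : 'I_(\dim {:V}) -> K :=
  fun i => coord (vbasis {:V}) i v.

Local Notation poly := {mpoly K[\dim {:V}]}.

Definition homogeneous (F : poly) : Prop := exists d : nat, F \is d.-homog.

(* For homogeneous [F] this does not depend on the representative of [x]. *)
Definition vanishes_at (F : poly) (x : projspace) : Prop :=
  F.@[coords (rep x)] = 0.

Definition zariski_closed (Z : set projspace) : Prop :=
  exists S : set poly,
    (forall F, S F -> homogeneous F) /\
    Z = [set x | forall F, S F -> vanishes_at F x].

Definition zariski_irreducible (Z : set projspace) : Prop :=
  Z !=set0 /\
  forall Z1 Z2, zariski_closed Z1 -> zariski_closed Z2 ->
    Z `<=` Z1 `|` Z2 -> Z `<=` Z1 \/ Z `<=` Z2.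

Definition irreducible_chain (X : set projspace) (x : projspace) (n : nat) : Prop :=
  exists Z : nat -> set projspace,
    (forall i, (i <= n)%N ->
       [/\ zariski_closed (Z i), zariski_irreducible (Z i), Z i `<=` X & Z i x]) /\
    (forall i, (i < n)%N -> Z i `<` Z i.+1).

(* For [X] closed, this is the Krull dimension of the local ring of [X] at [x]:
   its primes correspond to the irreducible closed subsets of [X] through [x]. *)
Definition local_dim (X : set projspace) (x : projspace) (d : nat) : Prop :=
  irreducible_chain X x d /\
  forall n, irreducible_chain X x n -> (n <= d)%N.

(* The homogeneous vanishing ideal of [X], through its homogeneous elements. *)
Definition vanishing_form (X : set projspace) (F : poly) : Prop :=
  homogeneous F /\ forall x, X x -> vanishes_at F x.

Definition differential (F : poly) (v w : V) : K :=
  \sum_(i < \dim {:V}) (F^`M(i)).@[coords v] * coords w i.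

(* [T] is the linear subspace of [V] whose projectivization is the embedded
   projective tangent space of [X] at [x] (kernel of the Jacobian matrix of the
   reduced homogeneous ideal of [X]); hence the Zariski tangent space of [X] at
   [x] has dimension [\dim T - 1]. *)
Definition is_tangent_space (X : set projspace) (x : projspace) (T : {vspace V}) :
    Prop :=
  forall w, w \in T <-> forall F, vanishing_form X F -> differential F (rep x) w = 0.

Definition smooth_at (X : set projspace) (x : projspace) : Prop :=
  exists (d : nat) (T : {vspace V}),
    [/\ local_dim X x d, is_tangent_space X x T & \dim T = d.+1].

Definition smooth (X : set projspace) : Prop := forall x, X x -> smooth_at X x.

End ProjectiveSpace.

Section Projectivities.
Variables (K : closedFieldType) (V W : vectType K).

Lemma linear_nonzero (phi : {linear V -> W}) (inj : injective phi)
  (u : nonzero V) : phi (val u) != 0.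
Proof. by rewrite -(linear0 phi) (inj_eq inj); exact: valP u. Qed.

Definition projmap (phi : {linear V -> W}) (inj : injective phi)
    (x : projspace V) : projspace W :=
  pt (exist _ (phi (rep x)) (linear_nonzero inj (repr x))).

Definition projectively_equivalent (X : set (projspace V)) (Y : set (projspace W)) :
    Prop :=
  exists (phi : {linear V -> W}) (bij : bijective phi),
    projmap (bij_inj bij) @` X = Y.

End Projectivities.

Section Segre.
Variable K : closedFieldType.

Lemma tens_nonzero (m n p q : nat) (A : 'M[K]_(m, n)) (B : 'M[K]_(p, q)) :
  A != 0 -> B != 0 -> A *t B != 0.
Proof.
move=> A0 B0; apply/eqP => AB0.
have [i [j Aij]] : exists i j, A i j != 0.
  apply: contrapT => nA; case/eqP: A0; apply/matrixP => i j; rewrite mxE.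
  by apply/eqP; apply: contraT => Aij; case: nA; exists i, j.
case/eqP: B0; apply/matrixP => k l.
have := congr1 (fun M : 'M__ => M (mxtens_index (i, k)) (mxtens_index (j, l))) AB0.
by rewrite tensmxE !mxE => /eqP; rewrite mulf_eq0 (negbTE Aij) => /eqP.
Qed.

Definition P1 := projspace 'rV[K]_2.
Definition P7 := projspace 'rV[K]_8.

(* The Kronecker product of three vectors of length 2 is the vector of length 8
   of all the products x_i y_j z_k. *)
Definition segre_map (p : P1 * P1 * P1) : P7 :=
  let: (x, y, z) := p in
  pt (exist (fun v : 'rV[K]_8 => v != 0) (rep x *t rep y *t rep z)
    (tens_nonzero (tens_nonzero (valP (repr x)) (valP (repr y))) (valP (repr z)))).

Definition segre : set P7 := range segre_map.

End Segre.

Definition matrix_pairs (K : closedFieldType) (m : nat) : vectType K :=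
  ('M[K]_m * 'M[K]_m)%type.

Definition Xdeg (K : closedFieldType) (m k : nat) : set (projspace (matrix_pairs K m)) :=
  projset [set AB : 'M[K]_m * 'M[K]_m |
    let: (A, B) := AB in
    [/\ A *m B^T = 0, B^T *m A = 0, (\rank A <= k)%N & (\rank B <= m - k)%N]].

Arguments segre K : clear implicits.
Arguments Xdeg K m k : clear implicits.

(* Main.v *)
(** Upper bounds for the local dimension come from algebraic independence: along
    a chain of irreducible closed sets through a point, each strict inclusion
    yields one more form that is algebraically independent on the cone of the
    larger set, while a cone covered by finitely many polynomial images of K^N
    carries at most N algebraically independent forms.  The pairs with
    A B^T = B^T A = 0 are covered by charts with m^2 parameters (block Gaussian
    elimination of A after permuting rows and columns), so all local dimensions of
    X_deg(m,k) are less than m^2.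

    If m > 2 and 0 < k < m, then k >= 2 or m - k >= 2; at a rank one point [A,0],
    resp. [0,B], the lines contained in X_deg(m,k) span a space of dimension
    greater than m^2, so that point is singular.  For (m,k) = (2,1), passing to
    the adjugate of B turns the equations into proportionality of two rank one
    matrices, that is, into the equations of the pure tensors x (x) y (x) z;
    the tangent space is cut out by four Segre quadrics, and the flag point <
    line < quadric surface < X gives the lower bound on the dimension. *)
Require Import Defs.
From HB Require Import structures.
From mathcomp Require Import all_fingroup.
From mathcomp Require Import all_boot all_order all_algebra ring.
From mathcomp Require Import boolp classical_sets reals.
From mathcomp Require Import complex mxtens mpoly.

Set Implicit Arguments.
Unset Strict Implicit.
Unset Printing Implicit Defensive.

Import GRing.Theory.
Local Open Scope classical_set_scope.
Local Open Scope quotient_scope.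
Local Open Scope ring_scope.

(** * Polynomials in several variables: splitting off the last variable, algebraic dependence *)

Section MultivariatePolynomials.
Variable K : fieldType.

Definition extend n (v : 'I_n -> K) (t : K) : 'I_n.+1 -> K :=
  fun i => oapp v t (unlift ord_max i).

Lemma extend_widen n (v : 'I_n -> K) t i :
  extend v t (widen_ord (leqnSn n) i) = v i.
Proof.
rewrite /extend (_ : widen_ord _ i = lift ord_max i) ?liftK //.
by apply: val_inj; rewrite /= /bump leqNgt ltn_ord.
Qed.

Lemma extend_max n (v : 'I_n -> K) t : extend v t ord_max = t.
Proof. by rewrite /extend unlift_none. Qed.

Definition restrict_mnm n (m : 'X_{1..n.+1}) : 'X_{1..n} :=
  [multinom m (widen_ord (leqnSn n) i) | i < n].

Lemma muniX n (m : 'X_{1..n.+1}) :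
  muni ('X_[m] : {mpoly K[n.+1]}) = 'X_[restrict_mnm m] *: 'X^(m ord_max).
Proof. by rewrite muniE msuppX big_seq1 mcoeffX eqxx scale1r. Qed.

Lemma muni_coef n (P : {mpoly K[n.+1]}) (m : 'X_{1..n.+1}) :
  ((muni P)`_(m ord_max))@_(restrict_mnm m) = P@_m.
Proof.
elim/mpolyind: P => [|c m0 p _ _ IH]; first by rewrite muni0 coef0 !mcoeff0.
rewrite muniD muniZ muniX coefD !mcoeffD IH coefZ coefZ coefXn mul_mpolyC.
rewrite !mcoeffZ mcoeffX; congr (c * _ + _).
case: eqP => [e|ne]; last first.
  by rewrite mulr0 mcoeff0; case: eqP => // e; case: ne; rewrite e.
rewrite mulr1 mcoeffX; congr (nat_of_bool _)%:R.
apply/eqP/eqP => [e'|->//]; apply/mnmP => i.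
have [j ->|->] := unliftP ord_max i; last by rewrite e.
have := congr1 (fun m : 'X_{1..n} => m j) e'; rewrite !mnmE.
rewrite (_ : widen_ord _ j = lift ord_max j) //.
by apply: val_inj; rewrite /= /bump leqNgt ltn_ord.
Qed.

Lemma muni_eq0 n (P : {mpoly K[n.+1]}) : muni P = 0 -> P = 0.
Proof.
by move=> P0; apply/mpolyP => m; rewrite -muni_coef P0 coef0 !mcoeff0.
Qed.

Lemma muni_eval n (P : {mpoly K[n.+1]}) v t :
  (map_poly (meval v) (muni P)).[t] = P.@[extend v t].
Proof.
elim/mpolyind: P => [|c m p _ _ IH].
  by rewrite muni0 rmorph0 horner0 meval0.
rewrite muniD muniZ muniX mevalD mevalZ.
rewrite (raddfD (map_poly (meval v))) /= hornerD IH; congr (_ + _).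
rewrite !map_polyZ /= map_polyXn !hornerZ hornerXn mevalC !mevalX; congr (_ * _).
rewrite big_ord_recr /= extend_max; congr (_ * _).
by apply: eq_bigr => i _; rewrite mnmE extend_widen.
Qed.

Lemma leq_msizeM n (p q : {mpoly K[n]}) a b :
  (msize p <= a.+1 -> msize q <= b.+1 -> msize (p * q) <= (a + b).+1)%N.
Proof.
have [->|p0] := eqVneq p 0; first by rewrite mul0r msize0.
have [->|q0] := eqVneq q 0; first by rewrite mulr0 msize0.
move=> pa qb; rewrite msizeM //.
have p1 : (0 < msize p)%N by rewrite lt0n msize_poly_eq0.
have q1 : (0 < msize q)%N by rewrite lt0n msize_poly_eq0.
move: pa qb p1 q1; case: (msize p) => // a'; case: (msize q) => // b' pa qb _ _.
by rewrite addSn addnS /= ltnS leq_add.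
Qed.

Lemma leq_msize_prod n r (g : 'I_r -> {mpoly K[n]}) (b : 'I_r -> nat) :
  (forall i, msize (g i) <= (b i).+1)%N ->
  (msize (\prod_i g i) <= (\sum_i b i).+1)%N.
Proof.
move=> gb; elim/big_rec2: _ => [|i k p _ IH]; first by rewrite msize1.
exact: leq_msizeM.
Qed.

Lemma leq_msizeX n (p : {mpoly K[n]}) a e :
  (msize p <= a.+1 -> msize (p ^+ e) <= (a * e).+1)%N.
Proof.
move=> pa; elim: e => [|e IH]; first by rewrite msize1.
by rewrite exprS mulnS; apply: leq_msizeM.
Qed.

(* There are more monomials of degree < D in each of r > n variables than
   monomials that can occur in their images, once D is large. *)
Lemma algebraic_dependence n r (g : 'I_r -> {mpoly K[n]}) : (n < r)%N ->
  exists2 P : {mpoly K[r]}, P != 0 & P \mPo [tuple g i | i < r] = 0.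
Proof.
move=> ltnr; pose e := (\max_i msize (g i))%N.
(* Exponents below [D] give images of degree below [c * D], hence at most [(c * D) ^ n] monomials.
   The choice [D > c ^ n] makes this smaller than [D ^ n.+1], which is at most [D ^ r]. *)
pose c := (r * e).+1; pose D := (c ^ n).+1.
pose A := {ffun 'I_r -> 'I_D}; pose B := {ffun 'I_n -> 'I_(c * D)}.
have ltBA : (#|B| < #|A|)%N.
  rewrite !card_ffun !card_ord expnMn; apply: (@leq_trans (D ^ n.+1)).
    by rewrite expnS ltn_pmul2r ?expn_gt0.
  by rewrite leq_pexp2l.
pose mA (a : A) : 'X_{1..r} := [multinom val (a i) | i < r].
pose mB (b : B) : 'X_{1..n} := [multinom val (b i) | i < n].
pose G (a : A) : {mpoly K[n]} := \prod_i g i ^+ a i.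
pose M := \matrix_(i < #|A|, j < #|B|) (G (enum_val i))@_(mB (enum_val j)).
(* The coefficient matrix [M] of the images has more rows than columns, so its rows satisfy a
   nontrivial linear relation; this relation gives the coefficients of [P]. *)
have /eqP kerM : kermx M != 0.
  rewrite -mxrank_eq0 mxrank_ker -lt0n subn_gt0.
  exact: leq_ltn_trans (rank_leq_col _) ltBA.
have [i ui] : exists i, row i (kermx M) != 0.
  apply: contrapT => nu; case: kerM; apply/row_matrixP => i; rewrite row0.
  by apply/eqP; apply: contraT => ri; case: nu; exists i.
set u := row i _ in ui.
have uM : u *m M = 0 by apply: sub_kermxP; rewrite row_sub.
have mA_inj : injective mA.
  move=> a a' e'; apply/ffunP => k; apply: val_inj.
  by have := congr1 (fun m : 'X_{1..r} => m k) e'; rewrite !mnmE.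
exists (\sum_(a : A) u 0 (enum_rank a) *: 'X_[mA a]).
  apply: contra ui => /eqP P0; apply/eqP/rowP => k; rewrite [RHS]mxE.
  have := congr1 (mcoeff (mA (enum_val k))) P0.
  rewrite mcoeff0 raddf_sum /= (bigD1 (enum_val k)) //= big1.
    by rewrite addr0 mcoeffZ mcoeffX eqxx mulr1 enum_valK.
  by move=> a ak; rewrite mcoeffZ mcoeffX (inj_eq mA_inj) (negbTE ak) mulr0.
have -> : (\sum_a u 0 (enum_rank a) *: 'X_[mA a]) \mPo [tuple g i | i < r] =
          \sum_(a : A) u 0 (enum_rank a) *: G a.
  rewrite raddf_sum; apply: eq_bigr => a _ /=.
  rewrite comp_mpolyZ comp_mpolyX; congr (_ *: _).
  by apply: eq_bigr => k _; rewrite tnth_mktuple mnmE.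
have sizeG a : (msize (G a) <= c * D)%N.
  apply: (@leq_trans (\sum_(k < r) e * a k).+1); last first.
    rewrite mulSn (@leq_trans (r * e * D).+1) //; last first.
      by rewrite -[(_ * D).+1]add1n leq_add.
    rewrite ltnS -mulnA -[X in (X * _)%N]card_ord -sum_nat_const leq_sum // => k _.
    by rewrite leq_mul // ltnW.
  apply: leq_msize_prod => k; apply: leq_msizeX.
  by rewrite leqW // (leq_bigmax k).
apply/mpolyP => m; rewrite mcoeff0 raddf_sum /=.
have [mD|] := ltnP (mdeg m) (c * D); last first.
  move=> mD; rewrite big1 // => a _; rewrite mcoeffZ memN_msupp_eq0 ?mulr0 //.
  by apply: msize_mdeg_ge; apply: leq_trans mD.
have mlt k : (m k < c * D)%N.
  by apply: leq_ltn_trans mD; rewrite mdegE (bigD1 k) //= leq_addr.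
pose b : B := [ffun k => Ordinal (mlt k)].
have -> : m = mB b by apply/mnmP => k; rewrite mnmE ffunE.
have := congr1 (fun N : 'rV_#|B| => N 0 (enum_rank b)) uM.
rewrite !mxE; apply: etrans.
rewrite (reindex (@enum_val A (fun=> true))) /=; last first.
  by exists enum_rank => ? _; rewrite ?enum_valK ?enum_rankK.
by apply: eq_bigr => k _; rewrite mcoeffZ !mxE !enum_valK enum_rankK.
Qed.

End MultivariatePolynomials.

(** * Chains of irreducible closed sets and algebraic independence on their cones *)

Section Chains.
Variables (K : closedFieldType) (V : vectType K).
Local Notation poly := {mpoly K[\dim {:V}]}.
Implicit Types (F G : poly) (v w : V) (X Z : set (projspace V)).

Lemma horner_eq0 (p : {poly K}) : (forall t, p.[t] = 0) -> p = 0.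
Proof.
move=> p0; apply/eqP; apply: contraT => /closed_nonrootP[t].
by rewrite /root p0 eqxx.
Qed.

Lemma coordsZ c v : coords (c *: v) =1 (fun i => c * coords v i).
Proof. by move=> i; rewrite /coords linearZ. Qed.

Lemma coordsD v w : coords (v + w) =1 (fun i => coords v i + coords w i).
Proof. by move=> i; rewrite /coords linearD. Qed.

Lemma coords0 : coords (0 : V) =1 (fun=> 0).
Proof. by move=> i; rewrite /coords linear0. Qed.

Lemma dhomog_evalZ d F c v : F \is d.-homog ->
  F.@[coords (c *: v)] = c ^+ d * F.@[coords v].
Proof.
move=> /dhomogP homF; rewrite (meval_eq _ (coordsZ c v)) !mevalE mulr_sumr.
rewrite !big_seq; apply: eq_bigr => m /homF /= <-.
rewrite mulrCA; congr (_ * _); rewrite mdegE -prodrXr -big_split /=.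
by apply: eq_bigr => i _; rewrite exprMn.
Qed.

Lemma rep_neq0 (x : projspace V) : rep x != 0.
Proof. exact: (valP (repr x)). Qed.

Lemma rep_pt (u : nonzero V) : exists2 c : K, c != 0 & rep (pt u) = c *: val u.
Proof.
suff /asboolP[c c0 e] : collinear u (repr (pt u)) by exists c.
by apply/(@eqmodP _ (collinear_equiv V)); rewrite reprK.
Qed.

Lemma pt_rep (x : projspace V) : pt (repr x) = x.
Proof. exact: reprK. Qed.

Lemma vanishes_at_pt F (u : nonzero V) : homogeneous F ->
  vanishes_at F (pt u) <-> F.@[coords (val u)] = 0.
Proof.
move=> [d homF]; have [c c0 e] := rep_pt u.
rewrite /vanishes_at e (dhomog_evalZ _ _ homF); split=> [/eqP|->]; last exact: mulr0.
by rewrite mulf_eq0 expf_eq0 (negbTE c0) andbF => /eqP.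
Qed.

Lemma zariski_closed_hypersurface F : homogeneous F ->
  zariski_closed [set x | vanishes_at F x].
Proof.
move=> homF; exists [set F]; split=> [_ ->//|]; apply/seteqP.
by split=> [x Fx _ ->|x]//; apply.
Qed.

(** The scalar may be zero, so the cone over a nonempty set contains the origin. *)
Definition cone Z : set V := [set v | exists x c, Z x /\ v = c *: rep x].

Lemma vanishes_cone Z F : homogeneous F -> (forall x, Z x -> vanishes_at F x) ->
  forall v, cone Z v -> F.@[coords v] = 0.
Proof.
move=> [d homF] FZ _ [x [c [Zx ->]]].
by rewrite (dhomog_evalZ _ _ homF) FZ // mulr0.
Qed.

(* Homogeneous closed sets only see homogeneous forms; the restriction that [G]
   is homogeneous lets one split [F] into its homogeneous components. *)
Lemma irreducible_cone_mul Z G F : zariski_irreducible Z -> homogeneous G ->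
  ~ (forall x, Z x -> vanishes_at G x) ->
  (forall v, cone Z v -> (G * F).@[coords v] = 0) ->
  forall v, cone Z v -> F.@[coords v] = 0.
Proof.
move=> [_ irrZ] homG nG GF0 v [x [c [Zx ->]]].
pose k := msize F.
have Fk : F = \sum_(d < k) pihomog mdeg d F by rewrite -pihomog_partitionE.
have comp0 (d : 'I_k) y : Z y ->
    G.@[coords (rep y)] * (pihomog mdeg d F).@[coords (rep y)] = 0.
  move=> Zy; have [e homeG] := homG.
  pose a i := G.@[coords (rep y)] * (pihomog mdeg i F).@[coords (rep y)].
  (* On the line through [rep y], the product [G * F] is this polynomial in the scaling parameter.
     It vanishes at every scalar, so each coefficient [a i] is zero. *)
  have : 'X^e * \poly_(i < k) a i = 0.
    apply: horner_eq0 => t; rewrite hornerM hornerXn horner_poly.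
    have /esym GFty : (G * F).@[coords (t *: rep y)] = 0 by apply: GF0; exists y, t.
    rewrite [RHS]GFty.
    rewrite mevalM (dhomog_evalZ _ _ homeG) -mulrA; congr (_ * _).
    rewrite [in RHS]Fk raddf_sum mulr_sumr. apply: eq_bigr => i _ /=.
    by rewrite (dhomog_evalZ _ _ (pihomogP _ _ _)) /a -mulrA [X in _ * X]mulrC.
  move/eqP; rewrite mulf_eq0 expf_eq0 polyX_eq0 andbF /= => /eqP a0.
  by have := congr1 (fun p : {poly K} => p`_d) a0; rewrite coef_poly ltn_ord coef0.
rewrite Fk raddf_sum big1 // => d _ /=.
have homd : homogeneous (pihomog mdeg d F) by exists d; apply: pihomogP.
(* Thus [Z] is covered by the hypersurface of [G] and that of the component of degree [d]; it does
   not lie in the first, so it lies in the second. *)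
have [] := irrZ _ _ (zariski_closed_hypersurface homG)
                    (zariski_closed_hypersurface homd).
- move=> y Zy; have /eqP := comp0 d y Zy; rewrite mulf_eq0.
  by case/orP => /eqP; [left|right].
- by move=> ZG; case: nG.
- by move=> Zd; rewrite (dhomog_evalZ _ _ (pihomogP _ _ _)) Zd ?mulr0.
Qed.

Definition independent_on (C : set V) r (f : 'I_r -> poly) : Prop :=
  forall P : {mpoly K[r]},
    (forall v, C v -> P.@[fun i => (f i).@[coords v]] = 0) -> P = 0.

Definition extend_fun r (f : 'I_r -> poly) G : 'I_r.+1 -> poly :=
  fun i => oapp f G (unlift ord_max i).

Lemma extend_funE r (f : 'I_r -> poly) G v :
  (fun i => (extend_fun f G i).@[coords v]) =1
  extend (fun i => (f i).@[coords v]) G.@[coords v].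
Proof. by move=> i; rewrite /extend_fun /extend; case: unlift. Qed.

(** Take a nonzero relation and factor out the largest power ['X^e] of its last variable, leaving
    [Q] with nonzero constant term. By irreducibility [G ^+ e] can be cancelled on the cone of [Z].
    On [C], where [G] vanishes, what remains is the constant term of [Q], a relation among the [f i]
    alone, contradicting their independence. *)
Lemma independent_on_extend (C : set V) Z r (f : 'I_r -> poly) G :
  zariski_irreducible Z -> C `<=` cone Z -> homogeneous G ->
  (forall v, C v -> G.@[coords v] = 0) -> ~ (forall x, Z x -> vanishes_at G x) ->
  independent_on C f -> independent_on (cone Z) (extend_fun f G).
Proof.
move=> irrZ CZ homG GC nG indf P P0; apply: muni_eq0.
have [//|Pn0] := eqVneq (muni P) 0.
have [e [Q Q0 PQ]] := multiplicity_XsubC (muni P) 0.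
move: Q0; rewrite Pn0 /= => /negP[]; apply/rootP.
pose H : poly := (map_poly (comp_mpoly [tuple f i | i < r]) Q).[G].
have evH v : H.@[coords v] =
    (map_poly (meval (fun i => (f i).@[coords v])) Q).[G.@[coords v]].
  rewrite /H -horner_map -map_poly_comp; congr _.[_].
  apply: eq_map_poly => q /=; rewrite comp_mpoly_meval.
  by apply: meval_eq => i; rewrite tnth_mktuple.
have nGe : ~ (forall x, Z x -> vanishes_at (G ^+ e) x).
  move=> Ge; apply: nG => x Zx; apply/eqP; have /eqP := Ge x Zx.
  by rewrite rmorphXn expf_eq0 => /andP[].
have homGe : homogeneous (G ^+ e) by case: homG => d /(dhomogMn e); exists (d * e)%N.
have H0 := irreducible_cone_mul irrZ homGe nGe.
apply: indf => v Cv; have := H0 H _ v (CZ _ Cv); rewrite evH GC //.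
rewrite horner_coef0 coef_map horner_coef0; apply=> w Zw.
rewrite mevalM evH mulrC; have := P0 w Zw.
rewrite (meval_eq _ (extend_funE f G w)) -muni_eval PQ rmorphM hornerM /=.
by rewrite subr0 map_polyXn hornerXn rmorphXn.
Qed.

Lemma exists_coord_neq0 v : v != 0 -> exists i, coords v i != 0.
Proof.
move=> v0; apply: contrapT => nv; case/eqP: v0.
rewrite (coord_vbasis (memvf v)) big1 // => i _.
have [->|ne] := eqVneq (coord (vbasis {:V}) i v) 0; first by rewrite scale0r.
by case: nv; exists i.
Qed.

Lemma subset_cone Y Z : Y `<=` Z -> cone Y `<=` cone Z.
Proof. by move=> YZ _ [x [c [/YZ Zx ->]]]; exists x, c. Qed.

Lemma chain_independent X x n : irreducible_chain X x n ->
  exists Z (f : 'I_n.+1 -> poly), Z `<=` X /\ independent_on (cone Z) f.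
Proof.
move=> [Z [HZ ltZ]]; suff: forall i, (i <= n)%N ->
    exists f : 'I_i.+1 -> poly, independent_on (cone (Z i)) f.
  by move=> /(_ n (leqnn n))[f ?]; exists (Z n), f; split=> //; case: (HZ n).
elim=> [_|i IH lein].
  have [_ irr0 _ Zx] := HZ 0%N (leq0n n).
  have [j xj] := exists_coord_neq0 (rep_neq0 x).
  (* The induction starts below the chain, from the origin with the empty family. A coordinate
     nonzero at [x] then gives the first form on [Z 0], which is why [n] strict inclusions produce
     [n.+1] forms. *)
  have indep0 : independent_on [set 0] (fun i : 'I_0 => 0).
    move=> P /(_ 0 erefl) P0; apply/mpolyP => m.
    have P1 : P = (P@_0)%:MP.
      apply/mpolyP => m'; rewrite (_ : m' = 0%MM) ?mcoeffC ?eqxx ?mulr1 //.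
      by apply/mnmP; case.
    by move: P0; rewrite P1 mevalC => ->; rewrite mpolyC0.
  exists (extend_fun (fun i : 'I_0 => 0) 'X_j).
  apply: (independent_on_extend irr0 _ _ _ _ indep0).
  - by move=> _ ->; exists x, 0; rewrite scale0r.
  - by exists 1%N; rewrite dhomogX /= mdeg1.
  - by move=> _ ->; rewrite mevalXU coords0.
  - by move=> /(_ _ Zx); rewrite /vanishes_at mevalXU => /eqP; rewrite (negbTE xj).
have [f indf] := IH (ltnW lein).
have [[S [homS eZ]] _ _ _] := HZ i (ltnW lein).
have [_ irr _ _] := HZ _ lein; have [ZZ nZ] := ltZ i lein.
(* If every equation of [Z i] vanished on [Z i.+1], the inclusion would not be strict. *)
have [G [SG nG]] : exists G, S G /\ ~ forall y, Z i.+1 y -> vanishes_at G y.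
  apply: contrapT => nS; apply: nZ => y Zy; rewrite eZ => G SG.
  by apply: contrapT => nG; apply: nS; exists G; split=> // /(_ y Zy).
exists (extend_fun f G); apply: (independent_on_extend irr _ (homS _ SG) _ nG indf).
- exact: subset_cone.
- apply: vanishes_cone; first exact: homS.
  by move=> y; rewrite eZ; apply.
Qed.

Definition polynomial_map N (phi : ('I_N -> K) -> V) : Prop :=
  forall i, exists P : {mpoly K[N]}, forall y, coords (phi y) i = P.@[y].

(** If [N <= n], the [n.+1] independent forms satisfy a nonzero relation on each chart. The product
    of these relations is still nonzero and holds on the whole cone, a contradiction. *)
Lemma irreducible_chain_lt X x n N (I : finType) (phi : I -> ('I_N -> K) -> V) :
  (forall i, polynomial_map (phi i)) ->
  (forall v, cone X v -> exists i y, v = phi i y) ->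
  irreducible_chain X x n -> (n < N)%N.
Proof.
move=> polphi covX /chain_independent[Z [f [ZX indf]]].
rewrite ltnNge; apply/negP => leNn.
have dep i : exists2 P : {mpoly K[n.+1]}, P != 0 &
    forall y, P.@[fun j => (f j).@[coords (phi i y)]] = 0.
  have /fin_all_exists[Q Qphi] := polphi i.
  have [P P0 Pf] := @algebraic_dependence K N n.+1
    (fun j => f j \mPo [tuple Q l | l < _]) leNn.
  exists P => // y; have := congr1 (meval y) Pf.
  rewrite meval0 comp_mpoly_meval => <-; apply: meval_eq => j.
  rewrite tnth_mktuple comp_mpoly_meval; apply: meval_eq => l.
  by rewrite tnth_mktuple Qphi.
have /fin_all_exists2[P P0 Pf] := dep.
have : \prod_i P i = 0.
  apply: indf => v /(subset_cone ZX)/covX[i [y ->]].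
  by rewrite rmorph_prod (bigD1 i) //= Pf mul0r.
by move/eqP; rewrite prodf_seq_eq0 => /hasP[i _ /=]; rewrite (negbTE (P0 i)).
Qed.

End Chains.

(** * Polynomials restricted to lines, differentials and linear forms *)

Section Lines.
Variables (K : closedFieldType) (V : vectType K).
Local Notation poly := {mpoly K[\dim {:V}]}.
Implicit Types (F G : poly) (v w : V).

Lemma differentialD F G v w :
  differential (F + G) v w = differential F v w + differential G v w.
Proof.
rewrite -big_split; apply: eq_bigr => i _ /=.
by rewrite mderivD mevalD mulrDl.
Qed.

Lemma differentialZ c F v w : differential (c *: F) v w = c * differential F v w.
Proof.
by rewrite mulr_sumr; apply: eq_bigr => i _; rewrite mderivZ mevalZ mulrA.
Qed.

Lemma differentialM F G v w :
  differential (F * G) v w =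
  differential F v w * G.@[coords v] + F.@[coords v] * differential G v w.
Proof.
rewrite mulr_suml mulr_sumr -big_split; apply: eq_bigr => i _ /=.
by rewrite mderivM mevalD !mevalM mulrDl mulrAC mulrA.
Qed.

Lemma differentialX i v w : differential 'X_i v w = coords w i.
Proof.
rewrite /differential (bigD1 i) //= big1 ?addr0 => [|j ji].
  rewrite mderivX mnm1E eqxx -[X in (X - U_(i))%MM]add0m addmK mpolyX0.
  by rewrite scale1r meval1 mul1r.
by rewrite mderivX mnm1E eq_sym (negbTE ji) scale0r meval0 mul0r.
Qed.

Lemma differentialC c v w : differential c%:MP v w = 0.
Proof. by rewrite /differential big1 // => i _; rewrite mderivC meval0 mul0r. Qed.

Lemma linear_differential F v : scalar (differential F v).
Proof.
move=> c u w; rewrite mulr_sumr -big_split; apply: eq_bigr => i _ /=.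
by rewrite coordsD coordsZ mulrDr mulrCA.
Qed.

(** Links the formal differential to the derivative along a line. The polynomials [F] with this
    property contain the constants and the variables and are stable under sums and, by the Leibniz
    rule, products. *)
Lemma line_poly F v w : exists p : {poly K},
  (forall t, p.[t] = F.@[coords (v + t *: w)]) /\ p^`().[0] = differential F v w.
Proof.
have zero G (p : {poly K}) : (forall t, p.[t] = G.@[coords (v + t *: w)]) ->
    p.[0] = G.@[coords v] by move=> ->; rewrite scale0r addr0.
pose Q G := exists p : {poly K},
  (forall t, p.[t] = G.@[coords (v + t *: w)]) /\ p^`().[0] = differential G v w.
have QD G H : Q G -> Q H -> Q (G + H).
  move=> [p [pG pd]] [q [qH qd]]; exists (p + q); rewrite derivD hornerD pd qd.
  by rewrite differentialD; split=> // t; rewrite hornerD pG qH mevalD.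
have QM G H : Q G -> Q H -> Q (G * H).
  move=> [p [pG pd]] [q [qH qd]]; exists (p * q).
  rewrite derivM hornerD !hornerM pd qd (zero G p) // (zero H q) // differentialM.
  by split=> // t; rewrite hornerM pG qH mevalM.
have QC c : Q c%:MP.
  by exists c%:P; rewrite derivC horner0 differentialC; split=> // t; rewrite hornerC mevalC.
have QX i : Q 'X_i.
  exists ((coords v i)%:P + (coords w i) *: 'X).
  rewrite derivD derivC add0r derivZ derivX hornerZ hornerC mulr1 differentialX.
  split=> // t; rewrite hornerD hornerC hornerZ hornerX mevalXU.
  by rewrite coordsD coordsZ [in RHS]mulrC.
suff : Q F by [].
rewrite [F]mpolyE; elim/big_ind: _ => [|//|m _]; first exact: (QC 0).
rewrite -mul_mpolyC; apply: (QM); first exact: (QC).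
rewrite mpolyXE_id; elim/big_ind: _ => [||i _]; [exact: (QC 1)|exact: QM|].
by elim: (m i) => [|k IH]; [exact: (QC 1)|rewrite exprS; exact: QM].
Qed.

(** A coordinate that is nonzero at [v] restricts to a second nonzero polynomial in [t]; any [t]
    that is not a root of the product of the two will do. *)
Lemma line_avoid v w (p : {poly K}) : v != 0 -> p != 0 ->
  exists t, v + t *: w != 0 /\ p.[t] != 0.
Proof.
move=> /exists_coord_neq0[j vj] p0.
have [q [qE _]] := line_poly 'X_j v w.
have q0 : q != 0.
  apply: contra vj => /eqP q0; have := qE 0.
  by rewrite q0 horner0 scale0r addr0 mevalXU => <-.
have /closed_nonrootP[t] : p * q != 0 by rewrite mulf_neq0.
rewrite rootM negb_or => /andP[pt qt]; exists t; split=> //.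
by apply: contra qt => /eqP e; rewrite /root qE e mevalXU coords0.
Qed.

(** Directions of lines contained in a set are tangent to it. The origin is excepted on the line
    because it defines no projective point. *)
Lemma differential_line F v w : v != 0 ->
  (forall t, v + t *: w != 0 -> F.@[coords (v + t *: w)] = 0) ->
  differential F v w = 0.
Proof.
move=> v0 F0; have [p [pF <-]] := line_poly F v w.
have [->|/(line_avoid w v0)[t [tn0]]] := eqVneq p 0.
  by rewrite derivC horner0.
by rewrite pF F0 ?eqxx.
Qed.

(** The two conditions are open in the same parameter [t], and nonempty because of [t = 0] and
    [t = 1] respectively. This is the source of all the irreducibility results. *)
Lemma line_common F G v w v' w' :
  F.@[coords v] != 0 -> G.@[coords (v' + w')] != 0 ->
  exists t, F.@[coords (v + t *: w)] != 0 /\ G.@[coords (v' + t *: w')] != 0.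
Proof.
move=> Fv Gw; have [p [pF _]] := line_poly F v w.
have [q [qG _]] := line_poly G v' w'.
have p0 : p != 0.
  apply: contra Fv => /eqP p0; have := pF 0.
  by rewrite p0 horner0 scale0r addr0 => <-.
have q0 : q != 0.
  apply: contra Gw => /eqP q0; have := qG 1.
  by rewrite q0 horner0 scale1r => <-.
have /closed_nonrootP[t] : p * q != 0 by rewrite mulf_neq0.
by rewrite /root hornerM mulf_eq0 negb_or pF qG => /andP[]; exists t.
Qed.

Definition linear_form (l : V -> K) : poly :=
  \sum_(i < \dim {:V}) l (vbasis {:V})`_i *: 'X_i.

Lemma linear_form_homog l : linear_form l \is 1.-homog.
Proof. by apply: rpred_sum => i _; apply: rpredZ; rewrite dhomogX /= mdeg1. Qed.

Lemma scalar_sum (U : lmodType K) (l : U -> K) (I : finType) (a : I -> K) (u : I -> U) :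
  scalar l -> l (\sum_i a i *: u i) = \sum_i a i * l (u i).
Proof.
move=> linl; have l0 : l 0 = 0.
  by have := linl (-1) 0 0; rewrite scaler0 addr0 mulN1r addNr.
by elim/big_rec2: _ => [//|i x y _ <-]; rewrite linl.
Qed.

Lemma linear_form_eval l v : scalar l -> (linear_form l).@[coords v] = l v.
Proof.
move=> linl; rewrite {2}(coord_vbasis (memvf v)) (scalar_sum _ _ linl) raddf_sum /=.
by apply: eq_bigr => i _; rewrite mevalZ mevalXU mulrC.
Qed.

Lemma differential_linear_form l v w : scalar l ->
  differential (linear_form l) v w = l w.
Proof.
move=> linl; rewrite -(linear_form_eval w linl) raddf_sum /=.
rewrite (big_morph (fun F => differential F v w) (id1 := 0) (op1 := +%R)).
- by apply: eq_bigr => i _; rewrite differentialZ differentialX mevalZ mevalXU.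
- by move=> F G; rewrite differentialD.
- by rewrite -mpolyC0 differentialC.
Qed.

(** The form is a coordinate of the component left after projecting onto [W], chosen to be nonzero
    at [v]. *)
Lemma separating_form (W : {vspace V}) v : v \notin W ->
  exists l : V -> K, [/\ scalar l, forall w, w \in W -> l w = 0 & l v != 0].
Proof.
move=> vW; have : v - projv W v != 0.
  apply: contra vW; rewrite subr_eq0 => /eqP->; exact: memv_proj.
move=> /exists_coord_neq0[i li]; exists (fun u => coords (u - projv W u) i); split=> //.
  by move=> c u w; rewrite linearP opprD addrACA -scalerBr coordsD coordsZ.
by move=> w wW; rewrite projv_id // subrr coords0.
Qed.

End Lines.

(** * Closedness and irreducibility of projective sets, read on vectors *)

Section Projsets.
Variables (K : closedFieldType) (V : vectType K).
Local Notation poly := {mpoly K[\dim {:V}]}.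
Implicit Types (F G : poly) (v w : V) (S : set V) (X : set (projspace V)).

Lemma projset_mem S x : S (rep x) -> projset S x.
Proof. by move=> Sx; exists (repr x) => //; apply: pt_rep. Qed.

Lemma mem_projset S v (v0 : v != 0) : S v -> projset S (pt (exist _ v v0)).
Proof. by move=> Sv; exists (exist _ v v0). Qed.

Lemma projset_rep S x : (forall c v, S v -> S (c *: v)) ->
  projset S x -> S (rep x).
Proof. by move=> Sc [u Su <-]; have [c _ ->] := rep_pt u; apply: Sc. Qed.

Lemma projset_pt S (u : nonzero V) : (forall c v, S v -> S (c *: v)) ->
  projset S (pt u) -> S (val u).
Proof.
move=> Sc /(projset_rep Sc); have [c c0 ->] := rep_pt u => /(Sc c^-1).
by rewrite scalerA mulVf // scale1r.
Qed.

Lemma cone_projset S v : (forall c u, S u -> S (c *: u)) ->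
  cone (projset S) v -> S v.
Proof. by move=> Sc [x [c [/(projset_rep Sc) Sx ->]]]; apply: Sc. Qed.

Lemma vanishing_form_projset S F v : vanishing_form (projset S) F -> S v ->
  v != 0 -> F.@[coords v] = 0.
Proof.
move=> [homF FS] Sv v0; apply/(vanishes_at_pt (exist _ v v0) homF).
by apply: FS; apply: mem_projset.
Qed.

Lemma zariski_closed_projset S (Fs : set poly) :
  (forall F, Fs F -> homogeneous F) ->
  (forall v, S v <-> forall F, Fs F -> F.@[coords v] = 0) ->
  zariski_closed (projset S).
Proof.
move=> homFs SE; exists Fs; split=> //; apply/seteqP; split=> x.
  by move=> [u Su <-] F FsF; apply/vanishes_at_pt; [exact: homFs|exact: (SE _).1].
by move=> Fx; apply: projset_mem; apply/SE.
Qed.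

(** Irreducibility in its dual form: two nonempty open subsets always meet. It suffices to test open
    sets given by the nonvanishing of one polynomial. *)
Lemma zariski_irreducible_projset S :
  (exists2 v, S v & v != 0) ->
  (forall F G v w, S v -> S w -> F.@[coords v] != 0 -> G.@[coords w] != 0 ->
     exists u, [/\ S u, F.@[coords u] != 0 & G.@[coords u] != 0]) ->
  zariski_irreducible (projset S).
Proof.
move=> [v0 Sv0 nv0] common; split.
  by exists (pt (exist _ v0 nv0)); apply: mem_projset.
have nonvanishing Z : zariski_closed Z -> ~ (projset S `<=` Z) ->
    exists F v, [/\ S v, v != 0, F.@[coords v] != 0 &
      forall w (w0 : w != 0), F.@[coords w] != 0 -> ~ Z (pt (exist _ w w0))].
  move=> [Fs [homFs ->]] nsub; apply: contrapT => nF; apply: nsub => x [u Su <-] F FsF.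
  apply/vanishes_at_pt; first exact: homFs.
  apply: contrapT => /eqP Fu; apply: nF; exists F, (val u); split=> //.
    exact: (valP u).
  move=> w w0 Fw /(_ F FsF)/vanishes_at_pt; rewrite /= => /(_ (homFs F FsF)) e.
  by rewrite e eqxx in Fw.
move=> Z1 Z2 cl1 cl2 sub; apply: contrapT => /not_orP[].
move=> /(nonvanishing _ cl1)[F [v [Sv v0' Fv FZ]]].
move=> /(nonvanishing _ cl2)[G [w [Sw w0 Gw GZ]]].
have [j vj] := exists_coord_neq0 v0'.
(* The factor ['X_j] forces the common vector [u] to be nonzero, so that it defines a point. *)
have [|u [Su]] := common (F * 'X_j) G v w Sv Sw _ Gw.
  by rewrite mevalM mevalXU mulf_neq0.
rewrite mevalM mevalXU mulf_eq0 negb_or => /andP[Fu uj] Gu.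
have u0 : u != 0 by apply: contra uj => /eqP->; rewrite coords0.
by have [/FZ|/GZ] := sub _ (mem_projset u0 Su); apply.
Qed.

Lemma irreducible_chain_extend X Y x n : irreducible_chain X x n ->
  X `<` Y -> zariski_closed Y -> zariski_irreducible Y ->
  irreducible_chain Y x n.+1.
Proof.
move=> [Z [HZ ltZ]] [XY nYX] clY irrY.
exists (fun i => if (i <= n)%N then Z i else Y); split=> i.
  move=> _; case: ifPn => [/HZ[? ? ZX ?]|_]; first by split=> // y /ZX/XY.
  by split=> //; have [_ _ ZX /ZX/XY] := HZ 0%N (leq0n n).
rewrite ltnS => lein; rewrite lein; case: ltnP => [/ltZ//|leni].
have <- : n = i by apply/eqP; rewrite eqn_leq leni.
have [_ _ ZX _] := HZ n (leqnn n); split; first by move=> y /ZX/XY.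
by move=> YZ; apply: nYX => y /YZ/ZX.
Qed.

Variable W : {vspace V}.
Let S : set V := [set v | v \in W].

Lemma vspace_scale c v : S v -> S (c *: v).
Proof. exact: memvZ. Qed.

Lemma zariski_closed_linear : zariski_closed (projset S).
Proof.
apply: (@zariski_closed_projset _
  [set F | homogeneous F /\ forall v, S v -> F.@[coords v] = 0]).
  by move=> F [].
move=> v; split=> [Sv F [_]|Fv]; first exact.
apply/negPn/negP => /separating_form[l [linl lW /eqP]]; apply.
rewrite -(linear_form_eval v linl); apply: Fv; split.
  by exists 1%N; exact: linear_form_homog.
by move=> w Sw; rewrite linear_form_eval // lW.
Qed.

Lemma zariski_irreducible_linear : (exists2 v, v \in W & v != 0) ->
  zariski_irreducible (projset S).
Proof.
move=> W0; apply: zariski_irreducible_projset => // F G v w Sv Sw Fv Gw.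
have Gw' : G.@[coords (v + (w - v))] != 0 by rewrite addrC subrK.
have [t [Ft Gt]] := line_common (w - v) Fv Gw'.
by exists (v + t *: (w - v)); split=> //; apply: memvD => //; apply: memvZ; apply: memvB.
Qed.

End Projsets.

(** * Linear subspaces are smooth *)

Section LinearSpaces.
Variables (K : closedFieldType) (V : vectType K).
Implicit Types (W U : {vspace V}) (x : projspace V).

Lemma dim_add_line U (w : V) : w \notin U -> \dim (U + <[w]>) = (\dim U).+1.
Proof.
move=> wU; have w0 : w != 0 by apply: contraNneq wU => ->; exact: mem0v.
rewrite dimv_disjoint_sum ?dim_vline ?w0 ?addn1 //.
apply/eqP; rewrite -subv0; apply/subvP => u; rewrite memv_cap => /andP[uU].
move=> /vlineP[c e]; rewrite e memv0 scaler_eq0 (negbTE w0) orbF.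
by apply: contraNT wU => c0; rewrite -(scale1r w) -(mulVf c0) -scalerA -e memvZ.
Qed.

(** A flag of subspaces is built by adding one vector at a time. Keeping [U] and its dimension in
    the statement lets [U] be identified with [W] when [i] is the last index. *)
Lemma linear_chain W x : rep x \in W ->
  forall i, (i < \dim W)%N -> exists U,
    [/\ rep x \in U, (U <= W)%VS, \dim U = i.+1
      & irreducible_chain (projset [set v | v \in U]) x i].
Proof.
move=> xW; have irr U : rep x \in U -> zariski_irreducible (projset [set v | v \in U]).
  by move=> xU; apply: zariski_irreducible_linear; exists (rep x) => //; apply: rep_neq0.
elim=> [|i IH] ltiW.
  exists <[rep x]>%VS; split; rewrite ?memv_line // ?dim_vline ?rep_neq0 //.
  exists (fun=> projset [set v | v \in <[rep x]>%VS]); split=> // _ _; split=> //.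
  - exact: zariski_closed_linear.
  - by apply: irr; apply: memv_line.
  - by apply: projset_mem; apply: memv_line.
have [U [xU UW dimU chainU]] := IH (ltnW ltiW).
have /subvPn[w wW wU] : ~~ (W <= U)%VS.
  by apply: contraL ltiW => /dimvS; rewrite dimU -leqNgt.
have w0 : w != 0 by apply: contraNneq wU => ->; exact: mem0v.
have UU' : (U <= U + <[w]>)%VS := addvSl _ _.
exists (U + <[w]>)%VS; split.
- exact: subvP UU' _ xU.
- by rewrite subv_add UW -memvE.
- by rewrite dim_add_line // dimU.
apply: irreducible_chain_extend chainU _ (zariski_closed_linear _) _; last first.
  by apply: irr; exact: subvP UU' _ xU.
split=> [y [u uU <-]|sub]; first by exists u => //; exact: subvP UU' _ uU.
have wUw : w \in (U + <[w]>)%VS by rewrite memvE addvSr.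
case/negP: wU; apply: (projset_pt (u := exist _ w w0) (@vspace_scale _ _ U)).
exact/sub/(mem_projset (S := [set v | v \in _])).
Qed.

(** The flag gives a chain of length [\dim W - 1], and a basis gives one linear chart with [\dim W]
    parameters, which bounds all chains. The tangent space is [W]: lines inside [W] give one
    inclusion, and the linear forms that vanish on [W] give the other. *)
Lemma smooth_linear W : smooth (projset [set v | v \in W]).
Proof.
move=> x /(projset_rep (@vspace_scale _ _ W)) /= xW.
have W0 : (0 < \dim W)%N.
  rewrite lt0n dimv_eq0; apply: contraTneq xW => ->.
  by rewrite memv0 rep_neq0.
exists (\dim W).-1, W; split; last by rewrite prednK.
- split=> [|n].
    have [|U [_ UW dimU]] := linear_chain xW (i := (\dim W).-1).
      by rewrite prednK.
    suff -> : U = W by [].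
    by apply/eqP; rewrite eqEdim UW dimU prednK /=.
  rewrite -ltnS prednK //.
  apply: (@irreducible_chain_lt _ _ _ _ _ _ unit
    (fun _ y => \sum_(i < \dim W) y i *: (vbasis W)`_i)).
    move=> _ j; exists (\sum_(i < \dim W) coords (vbasis W)`_i j *: 'X_i) => y.
    rewrite /coords linear_sum raddf_sum; apply: eq_bigr => i _ /=.
    by rewrite linearZ mevalZ mevalXU mulrC.
  move=> v /(cone_projset (@vspace_scale _ _ W)) vW.
  exists tt, (fun i => coord (vbasis W) i v); exact: coord_vbasis.
- move=> w; split=> [wW F FW|Fw].
    apply: differential_line; first exact: rep_neq0.
    move=> t; apply: vanishing_form_projset FW _.
    by rewrite /= memvD // memvZ.
  apply/negPn/negP => /separating_form[l [linl lW /eqP]]; apply.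
  rewrite -(differential_linear_form (rep x) w linl); apply: Fw; split.
    by exists 1%N; exact: linear_form_homog.
  move=> y /(projset_rep (@vspace_scale _ _ W)) yW.
  by rewrite /vanishes_at linear_form_eval // lW.
Qed.

End LinearSpaces.

(** * Charts for pairs of matrices whose products vanish in both orders *)

Section RankCharts.
Variable K : fieldType.

(** The values of [f] followed by the remaining indices list ['I_m] without repetition; the
    permutation reads off this list. *)
Lemma perm_extension r m (f : 'I_r -> 'I_m) (ler : (r <= m)%N) : injective f ->
  exists s : 'S_m, forall i, s (widen_ord ler i) = f i.
Proof.
move=> f_inj; pose L := codom f ++ enum [predC codom f].
have uL : uniq L.
  rewrite cat_uniq enum_uniq andbT map_inj_uniq ?enum_uniq //=.
  by apply/hasPn => x; rewrite mem_enum.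
have sL : size L = m.
  rewrite size_cat size_codom -cardE -[RHS](card_ord m) -(cardC (mem (codom f))).
  by rewrite card_codom // card_ord.
pose h (k : 'I_m) := nth k L k.
have h_inj : injective h.
  move=> j k; rewrite /h (set_nth_default j k) ?sL // => /eqP.
  by rewrite nth_uniq ?sL // => /eqP/val_inj.
exists (perm h_inj) => i; rewrite permE /h nth_cat size_codom card_ord /= ltn_ord.
by rewrite (nth_map i) ?size_enum_ord // nth_ord_enum.
Qed.

Lemma perm_mxK m (s : 'S_m) : (perm_mx s)^T *m perm_mx s = 1%:M :> 'M[K]_m.
Proof. by rewrite tr_perm_mx -perm_mxM mulVg perm_mx1. Qed.

(** A matrix of full column rank has [r] independent rows, and a permutation brings them to the
    top. *)
Lemma pid_mx_perm_unit m r (U : 'M[K]_(m, r)) : row_full U ->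
  exists s : 'S_m, (pid_mx r : 'M_(r, m)) *m perm_mx s *m U \in unitmx.
Proof.
move=> fullU; have ler : (r <= m)%N by rewrite -(eqP fullU) rank_leq_row.
have [s sf] := perm_extension ler (@fullrankfun_inj _ _ _ _ fullU).
exists s; have -> : (pid_mx r : 'M_(r, m)) *m perm_mx s *m U
    = rowsub (fullrankfun fullU) U; last exact: fullrowsub_unit.
rewrite -mulmxA -row_permE; apply/matrixP => i j; rewrite !mxE.
rewrite (bigD1 (widen_ord ler i)) //= big1 ?addr0 => [|k ki].
  by rewrite !mxE /= eqxx ltn_ord mul1r sf.
rewrite !mxE (_ : (i == k :> nat) = false) ?mul0r //.
by apply: contraNF ki => /eqP e; apply/eqP/val_inj.
Qed.

(** Write [Z] in blocks [Z00], [Z01], [Z10], [Z11] with diagonal sizes [r] and [m - r]. Then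
    [chartA] is the column [(1; Z10)] times [Z00] times the row [(1, Z01)], and [chartB] is the
    column [(-Z01; 1)] times [Z11] times the row [(-Z10, 1)]. Their products vanish in both orders,
    and the four blocks together account for exactly [m * m] parameters. *)
Definition chartA m r (Z : 'M[K]_m) : 'M_m :=
  let D := pid_mx r in let D' := copid_mx r in
  (D + D' *m Z *m D) *m (D *m Z *m D) *m (D + D *m Z *m D').

Definition chartB m r (Z : 'M[K]_m) : 'M_m :=
  let D := pid_mx r in let D' := copid_mx r in
  (D' - D *m Z *m D') *m (D' *m Z *m D') *m (D' - D' *m Z *m D).

(** Here [G] is the inverse of the upper left corner of [A], padded with zeros, and
    [A *m G *m A = A] says that this corner carries the whole rank. Then [A *m G] and [G *m A] are
    the column [(1; Z10)] and the row [(1, Z01)] of the chart; since [C] annihilates both, it is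
    determined by its lower right block. *)
Lemma corner_chart m r (A C G : 'M[K]_m) : (r <= m)%N ->
  let D := pid_mx r in
  D *m G = G -> G *m D = G -> D *m A *m G = D -> G *m A *m D = D ->
  A *m G *m A = A -> A *m C = 0 -> C *m A = 0 ->
  exists Z, A = chartA r Z /\ C = chartB r Z.
Proof.
move=> ler D DG GD DAG GAD AGA AC CA; pose D' : 'M[K]_m := copid_mx r.
have DD : D *m D = D by rewrite pid_mx_id.
have D'D' : D' *m D' = D' by rewrite copid_mx_id.
have DD' : D *m D' = 0 by rewrite mul_pid_mx_copid.
have D'D : D' *m D = 0 by rewrite mul_copid_mx_pid.
have mDD (N : 'M_m) : N *m D *m D = N *m D by rewrite -mulmxA DD.
have mD'D' (N : 'M_m) : N *m D' *m D' = N *m D' by rewrite -mulmxA D'D'.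
have mDD' (N : 'M_m) : N *m D *m D' = 0 by rewrite -mulmxA DD' mulmx0.
have mD'D (N : 'M_m) : N *m D' *m D = 0 by rewrite -mulmxA D'D mulmx0.
pose X := A *m G; pose Y := G *m A.
have XE : X = D + D' *m X *m D.
  rewrite /D' /copid_mx mulmxBl mul1mx mulmxBl -/D /X mulmxA DAG -mulmxA GD DD.
  by rewrite addrC subrK.
have YE : Y = D + D *m Y *m D'.
  rewrite /D' /copid_mx mulmxBr mulmx1 -/D /Y !mulmxA DG GAD.
  by rewrite addrC subrK.
have XMY : A = X *m (D *m A *m D) *m Y.
  by rewrite /X /Y !mulmxA -[A *m G *m D]mulmxA GD AGA -!mulmxA (mulmxA D) DG mulmxA.
have CX : C *m X = 0 by rewrite /X mulmxA CA mul0mx.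
have YC : Y *m C = 0 by rewrite /Y -mulmxA AC mulmx0.
clearbody X Y.
have CE : C = C *m D' *m (D' - D' *m X *m D).
  move: CX; rewrite {1}XE mulmxDr !mulmxA => /eqP; rewrite addr_eq0 => /eqP CD.
  rewrite mulmxBr !mulmxA !mD'D'. rewrite -CD.
  by rewrite -mulmxDr /D' /copid_mx addrNK mulmx1.
have CE' : C = (D' - D *m Y *m D') *m (D' *m C).
  move: YC; rewrite {1}YE mulmxDl => /eqP; rewrite addr_eq0 => /eqP DC.
  rewrite mulmxBl !mulmxA D'D' mD'D' -DC.
  by rewrite -mulmxDl /D' /copid_mx addrNK mul1mx.
(* One block comes from each of [A], [X], [Y] and [C]. *)
pose Z := D *m A *m D + D' *m X *m D + D *m Y *m D' + D' *m C *m D'.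
pose simp := (mulmxDl, mulmxDr, mulmxA, DD, D'D', DD', D'D, mDD, mD'D', mDD',
  mD'D, mul0mx, mulmx0, addr0, add0r).
have Z00 : D *m Z *m D = D *m A *m D by rewrite /Z !simp.
have Z10 : D' *m Z *m D = D' *m X *m D by rewrite /Z !simp.
have Z01 : D *m Z *m D' = D *m Y *m D' by rewrite /Z !simp.
have Z11 : D' *m Z *m D' = D' *m C *m D' by rewrite /Z !simp.
exists Z; rewrite /chartA /chartB -/D -/D' Z00 Z10 Z01 Z11 -XE -YE.
by split=> //; rewrite {1}CE' {1}CE !mulmxA.
Qed.

(** A rank factorization [A = U *m W] reduces the choice of an invertible corner to choosing
    independent rows of [U] and independent columns of [W]. After these permutations [B^T] plays the
    part of [C]. *)
Lemma rank_chart m (A B : 'M[K]_m) : A *m B^T = 0 -> B^T *m A = 0 ->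
  exists (r : 'I_m.+1) (s t : 'S_m) (Z : 'M_m),
    A = (perm_mx s)^T *m chartA r Z *m perm_mx t /\
    B = ((perm_mx t)^T *m chartB r Z *m perm_mx s)^T.
Proof.
move=> AB BA; have [r [U [W [AE fullU fullW]]]] : exists r (U : 'M_(m, r)) (W : 'M_(r, m)),
    [/\ A = U *m W, row_full U & row_full W^T].
  exists (\rank A), (col_base A), (row_base A).
  by rewrite mulmx_base col_base_full /row_full mxrank_tr eq_row_base.
have ler : (r <= m)%N by rewrite -(eqP fullU) rank_leq_row.
have [s unitU] := pid_mx_perm_unit fullU.
have [t unitW] := pid_mx_perm_unit fullW.
pose p' : 'M[K]_(r, m) := pid_mx r; pose p : 'M[K]_(m, r) := pid_mx r.
pose S : 'M[K]_m := perm_mx s; pose T : 'M[K]_m := perm_mx t.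
pose U1 := S *m U; pose W1 := W *m T^T.
pose C1 := p' *m U1; pose C2 := W1 *m p.
have {}unitU : C1 \in unitmx by rewrite /C1 /U1 mulmxA.
have {}unitW : C2 \in unitmx.
  by rewrite -unitmx_tr /C2 /W1 !trmx_mul trmxK tr_pid_mx mulmxA.
pose A1 := S *m A *m T^T; pose C := T *m B^T *m S^T.
(* The corner of [A1] is [C1 *m C2], whence the order of the inverses. *)
pose G := p *m invmx C2 *m invmx C1 *m p'.
have p'p : p' *m p = 1%:M by rewrite pid_mx_id // pid_mx_1.
have pp' : p *m p' = pid_mx r by rewrite pid_mx_id.
have A1E : A1 = U1 *m W1 by rewrite /A1 AE /U1 /W1 !mulmxA.
clearbody U1 W1.
have G1 : G *m U1 = p *m invmx C2 by rewrite /G -!mulmxA -/C1 mulVmx ?mulmx1.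
have G2 : W1 *m G = invmx C1 *m p' by rewrite /G !mulmxA -/C2 mulmxV ?mul1mx.
have [] := @corner_chart m r A1 C G ler.
- by rewrite -pp' /G !mulmxA -[p *m p' *m p]mulmxA p'p mulmx1.
- by rewrite -pp' /G !mulmxA -[_ *m p' *m p]mulmxA p'p mulmx1.
- rewrite A1E -2!mulmxA G2 -pp' (mulmxA U1) -mulmxA; congr (p *m _).
  by rewrite !mulmxA -/C1 mulmxV ?mul1mx.
- rewrite A1E mulmxA G1 -pp' mulmxA; congr (_ *m p').
  by rewrite -!mulmxA -/C2 mulVmx ?mulmx1.
- rewrite A1E -mulmxA (mulmxA G) G1 -!mulmxA; congr (U1 *m _).
  by rewrite 2!mulmxA -/C2 mulmxV ?mul1mx.
- rewrite /A1 /C !mulmxA -[_ *m T^T *m T]mulmxA perm_mxK mulmx1.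
  by rewrite -[S *m A *m _]mulmxA AB mulmx0 mul0mx.
- rewrite /A1 /C !mulmxA -[_ *m S^T *m S]mulmxA perm_mxK mulmx1.
  by rewrite -[T *m _ *m A]mulmxA BA mulmx0 mul0mx.
move=> Z [AZ CZ]; exists (Ordinal (ler : (r < m.+1)%N)), s, t, Z.
rewrite /= -AZ -CZ /A1 /C -/S -/T; split.
  by rewrite !mulmxA perm_mxK mul1mx -mulmxA perm_mxK mulmx1.
by rewrite !mulmxA perm_mxK mul1mx -mulmxA perm_mxK mulmx1 trmxK.
Qed.

End RankCharts.

(** * The dimension bound for [Xdeg], and the cases [k = 0] and [k = m] *)

Section DegeneratePairs.
Variables (K : closedFieldType) (m : nat).
Local Notation V := (matrix_pairs K m).

Definition Xdeg_cone k : set V :=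
  [set AB : 'M[K]_m * 'M[K]_m |
    let: (A, B) := AB in
    [/\ A *m B^T = 0, B^T *m A = 0, (\rank A <= k)%N & (\rank B <= m - k)%N]].

Lemma XdegE k : Xdeg K m k = projset (Xdeg_cone k).
Proof. by []. Qed.

Lemma Xdeg_cone_scale k c v : Xdeg_cone k v -> Xdeg_cone k (c *: v).
Proof.
case: v => A B [AB BA rA rB]; split; rewrite ?linearZ /= -?scalemxAl -?scalemxAr.
- by rewrite AB !scaler0.
- by rewrite BA !scaler0.
- exact: leq_trans (mxrank_scale _ _) rA.
- exact: leq_trans (mxrank_scale _ _) rB.
Qed.

Definition polynomial_fun N (f : ('I_N -> K) -> K) : Prop :=
  exists P : {mpoly K[N]}, forall y, f y = P.@[y].

Definition polynomial_mx N p q (M : ('I_N -> K) -> 'M[K]_(p, q)) : Prop :=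
  forall i j, polynomial_fun (fun y => M y i j).

Lemma polynomial_fun_sum N (I : finType) (a : I -> K) (f : I -> ('I_N -> K) -> K) :
  (forall i, polynomial_fun (f i)) -> polynomial_fun (fun y => \sum_i f i y * a i).
Proof.
move=> /fin_all_exists[P fP]; exists (\sum_i a i *: P i) => y.
by rewrite raddf_sum; apply: eq_bigr => i _ /=; rewrite mevalZ fP mulrC.
Qed.

Lemma polynomial_mx_const N p q (M : 'M[K]_(p, q)) : polynomial_mx (fun y : 'I_N -> K => M).
Proof. by move=> i j; exists (M i j)%:MP => y; rewrite mevalC. Qed.

Lemma polynomial_mxD N p q (M M' : ('I_N -> K) -> 'M[K]_(p, q)) :
  polynomial_mx M -> polynomial_mx M' -> polynomial_mx (fun y => M y + M' y).
Proof.
move=> polM polM' i j; have [P MP] := polM i j; have [P' MP'] := polM' i j.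
by exists (P + P') => y; rewrite mevalD -MP -MP' mxE.
Qed.

Lemma polynomial_mxM N p q r (M : ('I_N -> K) -> 'M[K]_(p, q))
    (M' : ('I_N -> K) -> 'M[K]_(q, r)) :
  polynomial_mx M -> polynomial_mx M' -> polynomial_mx (fun y => M y *m M' y).
Proof.
move=> polM polM' i j; have /fin_all_exists[P MP] := polM i.
have /fin_all_exists[P' MP'] := fun k => polM' k j.
exists (\sum_k P k * P' k) => y; rewrite mxE raddf_sum /=.
by apply: eq_bigr => k _; rewrite mevalM MP MP'.
Qed.

Lemma polynomial_mxN N p q (M : ('I_N -> K) -> 'M[K]_(p, q)) :
  polynomial_mx M -> polynomial_mx (fun y => - M y).
Proof.
by move=> polM i j; have [P MP] := polM i j; exists (- P) => y; rewrite mxE mevalN MP.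
Qed.

Lemma polynomial_mx_tr N p q (M : ('I_N -> K) -> 'M[K]_(p, q)) :
  polynomial_mx M -> polynomial_mx (fun y => (M y)^T).
Proof. by move=> polM i j; have [P MP] := polM j i; exists P => y; rewrite mxE. Qed.

Lemma polynomial_chart N r (Z : ('I_N -> K) -> 'M[K]_m) : polynomial_mx Z ->
  polynomial_mx (fun y => chartA r (Z y)) /\ polynomial_mx (fun y => chartB r (Z y)).
Proof.
by move=> polZ; split; rewrite /chartA /chartB;
  repeat first [exact: polZ | exact: polynomial_mx_const
    | apply: polynomial_mxM | apply: polynomial_mxD | apply: polynomial_mxN].
Qed.

Definition pair_left (A : 'M[K]_m) : V := (A, 0).
Definition pair_right (B : 'M[K]_m) : V := (0, B).

Fact pair_left_linear : linear pair_left.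
Proof. by move=> c A B; congr pair; rewrite /= ?scaler0 ?addr0. Qed.

Fact pair_right_linear : linear pair_right.
Proof. by move=> c A B; congr pair; rewrite /= ?scaler0 ?addr0. Qed.

HB.instance Definition _ :=
  GRing.isLinear.Build K 'M[K]_m V *:%R pair_left pair_left_linear.
HB.instance Definition _ :=
  GRing.isLinear.Build K 'M[K]_m V *:%R pair_right pair_right_linear.

Lemma pairE (A B : 'M[K]_m) : (A, B) = pair_left A + pair_right B :> V.
Proof. by congr pair; rewrite /= ?addr0 ?add0r. Qed.

(** The coordinates of [V] refer to an unspecified basis, so each matrix is expanded in elementary
    matrices and linearity of the two injections is used. *)
Lemma polynomial_map_pair N (A B : ('I_N -> K) -> 'M[K]_m) :
  polynomial_mx A -> polynomial_mx B -> polynomial_map (fun y => (A y, B y) : V).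
Proof.
have poli (i : {linear 'M[K]_m -> V}) (M : ('I_N -> K) -> 'M[K]_m) l :
    polynomial_mx M -> polynomial_fun (fun y => coords (i (M y)) l).
  move=> polM; have := @polynomial_fun_sum N ('I_m * 'I_m)%type
    (fun kl => coords (i (delta_mx kl.1 kl.2)) l) (fun kl y => M y kl.1 kl.2) _.
  case=> [kl|P MP]; first exact: polM.
  exists P => y; rewrite -MP {1}[M y]matrix_sum_delta pair_big /= /coords !linear_sum.
  by apply: eq_bigr => kl _ /=; rewrite !linearZ.
move=> polA polB l; have [P AP] := poli pair_left _ l polA.
have [Q BQ] := poli pair_right _ l polB; exists (P + Q) => y.
by rewrite pairE coordsD mevalD AP BQ.
Qed.

(** The charts are indexed by a rank and two permutations; the parameters of each are the [m * m]
    entries of [Z]. *)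
Lemma Xdeg_chain_lt k x n : irreducible_chain (Xdeg K m k) x n -> (n < m * m)%N.
Proof.
pose Z (y : 'I_(m * m) -> K) : 'M_m := vec_mx (\row_i y i).
have polZ : polynomial_mx Z.
  by move=> i j; exists 'X_(mxvec_index i j) => y; rewrite !mxE mevalXU.
apply: (@irreducible_chain_lt _ _ _ _ _ _ ('I_m.+1 * 'S_m * 'S_m)%type
  (fun c y => let: (r, s, t) := c in
    ((perm_mx s)^T *m chartA r (Z y) *m perm_mx t,
     ((perm_mx t)^T *m chartB r (Z y) *m perm_mx s)^T))).
  move=> [[r s] t]; have [polA polB] := polynomial_chart r polZ.
  apply: polynomial_map_pair.
    by repeat first [exact: polA | exact: polynomial_mx_const | apply: polynomial_mxM].
  apply: polynomial_mx_tr.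
  by repeat first [exact: polB | exact: polynomial_mx_const | apply: polynomial_mxM].
move=> [A B] /(cone_projset (@Xdeg_cone_scale k)) [AB BA _ _].
have [r [s [t [M [AM BM]]]]] := rank_chart AB BA.
exists (r, s, t), (fun i => mxvec M 0 i).
have -> : Z (fun i => mxvec M 0 i) = M.
  by rewrite /Z -[RHS]mxvecK; congr vec_mx; apply/rowP => i; rewrite mxE.
by rewrite -AM -BM.
Qed.

Lemma Xdeg0_linear : Xdeg K m 0 = projset [set v | v \in lker (linfun (fst : V -> _))].
Proof.
rewrite XdegE; congr projset; apply/seteqP; split=> -[A B]; rewrite /= memv_ker lfunE /=.
  by case=> _ _; rewrite leqn0 mxrank_eq0.
by move=> /eqP->; rewrite mul0mx mulmx0 mxrank0 subn0 rank_leq_row.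
Qed.

Lemma Xdegm_linear : Xdeg K m m = projset [set v | v \in lker (linfun (snd : V -> _))].
Proof.
rewrite XdegE; congr projset; apply/seteqP; split=> -[A B]; rewrite /= memv_ker lfunE /=.
  by case=> _ _ _; rewrite subnn leqn0 mxrank_eq0.
by move=> /eqP->; rewrite trmx0 mul0mx mulmx0 mxrank0 rank_leq_row.
Qed.

End DegeneratePairs.

(** * Singular points of rank one *)

Section Singular.
Variables (K : closedFieldType).

(** At a smooth point the tangent space has dimension [d.+1 <= N], yet it contains [U]. *)
Lemma not_smooth_at (V : vectType K) (X : set (projspace V)) x N (U : {vspace V}) :
  (forall n, irreducible_chain X x n -> (n < N)%N) -> (N < \dim U)%N ->
  (forall w F, w \in U -> vanishing_form X F -> differential F (rep x) w = 0) ->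
  ~ smooth_at X x.
Proof.
move=> ltN ltU UT [d [T [[chd _] TT dimT]]].
have /dimvS : (U <= T)%VS by apply/subvP => w wU; apply/TT => F; apply: UT.
by rewrite dimT leqNgt (leq_ltn_trans (ltN _ chd) ltU).
Qed.

Variables (m k : nat) (lt1m : (1 < m)%N).
Local Notation V := (matrix_pairs K m).
Let o : 'I_m := Ordinal (ltnW lt1m).
Let o' : 'I_m := Ordinal lt1m.

(* The tangent space at a rank one point contains the whole factor through which
   it enters, and one more direction. *)
Lemma rank_one_not_smooth (i i' : {linear 'M[K]_m -> V}) :
  injective i -> (forall A, i' (delta_mx o' o') != i A) ->
  (forall c t j l, Xdeg_cone k (i (c *: delta_mx o o + t *: delta_mx j l))) ->
  (forall c t, Xdeg_cone k (i (c *: delta_mx o o) + t *: i' (delta_mx o' o'))) ->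
  ~ smooth (Xdeg K m k).
Proof.
move=> inj_i i'i Xi Xi' smX.
have e0 : i (delta_mx o o) != 0.
  rewrite -(linear0 i) (inj_eq inj_i) -mxrank_eq0 mxrank_delta //.
pose u := exist (fun v : V => v != 0) _ e0; pose x := pt u.
have Xx : Xdeg K m k x.
  by exists u => //; have := Xi 1 0 o o; rewrite scale1r scale0r addr0.
have [c c0 xE] : exists2 c, c != 0 & rep x = i (c *: delta_mx o o).
  by have [c c0 e] := rep_pt u; exists c; rewrite ?linearZ.
have tangent w F : (forall t, Xdeg_cone k (rep x + t *: w)) ->
    vanishing_form (Xdeg K m k) F -> differential F (rep x) w = 0.
  move=> Xw vanF; apply: differential_line; first exact: rep_neq0.
  by move=> t; apply: vanishing_form_projset vanF (Xw t).
apply: (not_smooth_at (@Xdeg_chain_lt _ _ _ _) _ _ (smX x Xx)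
  (U := (limg (linfun i) + <[i' (delta_mx o' o')]>)%VS)).
  (* The image of [i] has dimension [m * m], and the additional direction lies outside it, so [U]
     exceeds the bound on chains by one. *)
  have ker0 : lker (linfun i) == 0%VS by apply/lker0P => A B; rewrite !lfunE; apply: inj_i.
  rewrite dim_add_line ?limg_dim_eq ?dimvf ?dim_matrix ?(eqP ker0) ?capv0 //.
  by apply/negP => /memv_imgP[A _ /eqP]; rewrite lfunE (negbTE (i'i A)).
move=> w F /memv_addP[w1 /memv_imgP[A _ ->] [w2 /vlineP[a ->] ->]] vanF.
have lin := linear_differential F (rep x).
rewrite addrC lin [X in _ * X]tangent ?mulr0 ?add0r //; last first.
  by move=> t; rewrite xE; apply: Xi'.
(* Only elementary directions are known to give lines inside the cone; linearity of the differential
   yields all of [U]. *)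
rewrite lfunE {1}[A]matrix_sum_delta pair_big linear_sum /=.
under eq_bigr do rewrite linearZ.
rewrite (scalar_sum _ _ lin) big1 // => jl _; rewrite tangent ?mulr0 // => t.
by rewrite xE -linearZ -linearD; apply: Xi.
Qed.

Lemma delta_mul (a b c d : 'I_m) : b != d ->
  delta_mx a b *m (delta_mx c d)^T = 0 :> 'M[K]_m.
Proof. by move=> bd; rewrite trmx_delta mul_delta_mx_0. Qed.

(** A sum of two rank one matrices must fit in one factor: the first if [k >= 2], the second if
    [k = 1], where [m > 2] gives [m - k >= 2]. The direction taken in the other factor is an
    elementary matrix sharing no row or column with the base point, so both products vanish. *)
Lemma Xdeg_not_smooth : (2 < m)%N -> (0 < k)%N -> (k < m)%N -> ~ smooth (Xdeg K m k).
Proof.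
move=> lt2m k0 ltkm; have oo' : o != o' by [].
have rank2 c t (j l : 'I_m) :
    (\rank (c *: delta_mx o o + t *: delta_mx j l : 'M[K]_m)%R <= 2)%N.
  apply: leq_trans (mxrank_add _ _) _.
  by rewrite (@leq_add _ _ 1 1) // (leq_trans (mxrank_scale _ _)) ?mxrank_delta.
have rank1 c (j : 'I_m) : (\rank (c *: delta_mx j j : 'M[K]_m)%R <= 1)%N.
  by rewrite (leq_trans (mxrank_scale _ _)) ?mxrank_delta.
have [lt1k|lek1] := ltnP 1 k.
- apply: (@rank_one_not_smooth (@pair_left K m) (@pair_right K m)).
  + by move=> A B [].
  + move=> A; apply/eqP => -[_ /eqP].
    by rewrite -mxrank_eq0 mxrank_delta.
  + move=> c t j l; split; rewrite ?trmx0 ?mulmx0 ?mul0mx ?mxrank0 //.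
    exact: leq_trans (rank2 _ _ _ _) lt1k.
  + move=> c t; rewrite -linearZ -pairE; split.
    * by rewrite linearZ -scalemxAl -scalemxAr delta_mul ?scaler0.
    * by rewrite -scalemxAr linearZ /= -scalemxAl trmx_delta mul_delta_mx_0 ?scaler0.
    * exact: leq_trans (rank1 _ _) k0.
    * by rewrite (leq_trans (rank1 _ _)) ?subn_gt0.
- have {}k1 : k = 1%N by apply/eqP; rewrite eqn_leq lek1.
  apply: (@rank_one_not_smooth (@pair_right K m) (@pair_left K m)).
  + by move=> A B [].
  + move=> A; apply/eqP => -[/eqP].
    by rewrite -mxrank_eq0 mxrank_delta.
  + move=> c t j l; split; rewrite ?trmx0 ?mulmx0 ?mul0mx ?mxrank0 //.
    by rewrite (leq_trans (rank2 _ _ _ _)) // k1 ltn_subRL.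
  + move=> c t; rewrite -linearZ addrC -pairE; split.
    * by rewrite linearZ -scalemxAl -scalemxAr delta_mul ?scaler0.
    * by rewrite -scalemxAr linearZ /= -scalemxAl trmx_delta mul_delta_mx_0 ?scaler0.
    * exact: leq_trans (rank1 _ _) k0.
    * by rewrite (leq_trans (rank1 _ _)) ?subn_gt0.
Qed.
End Singular.

(** * Pairs of two by two matrices as tensors of format 2 x 2 x 2 *)

Section TwoByTwo.
Variable K : closedFieldType.
Local Notation V := (matrix_pairs K 2).
Local Notation vec := (bool -> K).
Implicit Types (x y z a b c p q r : vec) (v w : V).

(** Boolean indices make case analysis compute, and negation exchanges the two indices as in the
    adjugate. *)
Definition ord_bool (i : bool) : 'I_2 := if i then ord_max else ord0.
Definition bool_ord (i : 'I_2) : bool := i != ord0.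

Lemma ord_boolK : cancel ord_bool bool_ord. Proof. by case. Qed.

Lemma bool_ordK : cancel bool_ord ord_bool.
Proof. by case=> [[|[|i]] lti] //; apply: val_inj. Qed.

Definition sign2 (i j : bool) : K := if i (+) j then -1 else 1.

Lemma sign2N i j : sign2 (~~ i) (~~ j) = sign2 i j.
Proof. by case: i j => -[]. Qed.

Lemma sign2_neq0 i j : sign2 i j != 0.
Proof. by rewrite /sign2; case: ifP; rewrite ?oppr_eq0 oner_neq0. Qed.

Lemma sign2K i j t : sign2 i j * (sign2 i j * t) = t.
Proof. by case: i j => -[]; rewrite /sign2 /=; ring. Qed.

(* [B] is replaced by its adjugate transpose, which turns the equations of
   [Xdeg 2 1] into the proportionality of two rank one matrices. *)
Definition tensor v (i j l : bool) : K :=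
  if l then sign2 i j * v.2 (ord_bool (~~ i)) (ord_bool (~~ j))
  else v.1 (ord_bool i) (ord_bool j).

Definition of_tensor (t : bool -> bool -> bool -> K) : V :=
  (\matrix_(i, j) t (bool_ord i) (bool_ord j) false,
   \matrix_(i, j) (sign2 (bool_ord i) (bool_ord j) *
     t (~~ bool_ord i) (~~ bool_ord j) true)).

Lemma of_tensorK t i j l : tensor (of_tensor t) i j l = t i j l.
Proof.
rewrite /tensor; case: l; rewrite !mxE !ord_boolK ?negbK //.
by rewrite sign2N sign2K.
Qed.

Lemma tensorK v : of_tensor (tensor v) = v.
Proof.
case: v => A B; congr pair; apply/matrixP => i j; rewrite !mxE /tensor /=.
  by rewrite !bool_ordK.
by rewrite !negbK !bool_ordK sign2N sign2K.
Qed.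

Lemma tensor_inj v w : (forall i j l, tensor v i j l = tensor w i j l) -> v = w.
Proof.
move=> e; rewrite -(tensorK v) -(tensorK w); congr pair.
  by apply/matrixP => i j; rewrite !mxE e.
by apply/matrixP => i j; rewrite !mxE e.
Qed.

Lemma tensor_linear i j l : scalar (fun v => tensor v i j l).
Proof. by move=> t v w; rewrite /tensor; case: l; rewrite /= !mxE //; ring. Qed.

Lemma tensorD v w i j l : tensor (v + w) i j l = tensor v i j l + tensor w i j l.
Proof. by rewrite /tensor; case: l; rewrite /= !mxE //; ring. Qed.

Lemma tensorZ t v i j l : tensor (t *: v) i j l = t * tensor v i j l.
Proof. by rewrite /tensor; case: l; rewrite /= !mxE //; ring. Qed.

Definition tau x y z : V := of_tensor (fun i j l => x i * y j * z l).

Lemma tensor_tau x y z i j l : tensor (tau x y z) i j l = x i * y j * z l.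
Proof. exact: of_tensorK. Qed.

Lemma tau_line1 x p y z t :
  tau (fun i => x i + t * p i) y z = tau x y z + t *: tau p y z.
Proof.
by apply: tensor_inj => i j l; rewrite tensorD tensorZ !tensor_tau; ring.
Qed.

Lemma tau_line2 x y p z t :
  tau x (fun i => y i + t * p i) z = tau x y z + t *: tau x p z.
Proof.
by apply: tensor_inj => i j l; rewrite tensorD tensorZ !tensor_tau; ring.
Qed.

Lemma tau_line3 x y z p t :
  tau x y (fun i => z i + t * p i) = tau x y z + t *: tau x y p.
Proof.
by apply: tensor_inj => i j l; rewrite tensorD tensorZ !tensor_tau; ring.
Qed.

Lemma tau_scale t x y z : t *: tau x y z = tau (fun i => t * x i) y z.
Proof. by apply: tensor_inj => i j l; rewrite tensorZ !tensor_tau; ring. Qed.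

(** [swap1] and [swap2] are the 2 x 2 minors of the two flattenings that single out the first,
    respectively the second, tensor index. *)
Definition swap1 v := forall i j l i' j' l',
  tensor v i j l * tensor v i' j' l' = tensor v i' j l * tensor v i j' l'.
Definition swap2 v := forall i j l i' j' l',
  tensor v i j l * tensor v i' j' l' = tensor v i j' l * tensor v i' j l'.

(** The factors are the three fibres through a nonzero entry [n], two of them divided by [n].
    Exchanging indices turns [n * n] times any entry into the product of the fibre entries. *)
Lemma swap_tau v : swap1 v /\ swap2 v <-> exists x y z, v = tau x y z.
Proof.
split=> [[s1 s2]|[x [y [z ->]]]]; last first.
  by split=> i j l i' j' l'; rewrite !tensor_tau; ring.
have [[i0 [j0 [l0 /eqP v0]]]|v0] :=
    pselect (exists i j l, tensor v i j l <> 0); last first.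
  exists (fun=> 0), (fun=> 0), (fun=> 0); apply: tensor_inj => i j l.
  by rewrite tensor_tau !mul0r; apply: contrapT => ne; apply: v0; exists i, j, l.
set n := tensor v i0 j0 l0 in v0.
exists (fun i => tensor v i j0 l0), (fun j => tensor v i0 j l0 / n),
  (fun l => tensor v i0 j0 l / n); apply: tensor_inj => i j l.
rewrite tensor_tau; apply: (mulfI (mulf_neq0 v0 v0)).
transitivity (tensor v i j0 l0 * tensor v i0 j l0 * tensor v i0 j0 l); last first.
  by field.
rewrite (s1 i) -/n -!mulrA; congr (n * _).
by rewrite (s1 i) (s2 i0) mulrC.
Qed.

Lemma rank2_le1 (A : 'M[K]_2) : (\rank A <= 1)%N <->
  A ord0 ord0 * A ord_max ord_max = A ord0 ord_max * A ord_max ord0.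
Proof.
have detA : \det A = A ord0 ord0 * A ord_max ord_max - A ord0 ord_max * A ord_max ord0.
  rewrite (expand_det_row _ ord0) !big_ord_recl big_ord0 addr0 /cofactor !det_mx11.
  rewrite !mxE /= expr0 expr1 mulN1r mul1r mulrN.
  by congr (A _ _ * A _ _ - A _ _ * A _ _); apply: val_inj.
have -> : (\rank A <= 1)%N = (\det A == 0).
  rewrite -[RHS]negbK -unitfE -unitmxE -row_full_unit /row_full.
  by have := rank_leq_row A; case: (\rank A) => [|[|[|]]].
by rewrite detA subr_eq0; split=> [/eqP|->].
Qed.

Lemma mx22_eq0 (M : 'M[K]_2) :
  M = 0 <-> forall i j, M (ord_bool i) (ord_bool j) = 0.
Proof.
split=> [-> i j|M0]; first by rewrite mxE.
by apply/matrixP => i j; rewrite -(bool_ordK i) -(bool_ordK j) M0 mxE.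
Qed.

Lemma sum_ord_bool (f : 'I_2 -> K) : \sum_i f i = f (ord_bool false) + f (ord_bool true).
Proof.
by rewrite !big_ord_recl big_ord0 addr0; congr (f _ + f _); apply: val_inj.
Qed.

(** Between the two slices of the tensor, [A *m B^T = 0] exchanges second indices and [B^T *m A = 0]
    exchanges first indices; the rank conditions are the minors within each slice. Together they
    amount to [swap1] and [swap2]. *)
Lemma Xdeg_coneP v : Xdeg_cone 1 v <-> exists x y z, v = tau x y z.
Proof.
rewrite -swap_tau; case: v => A B /=.
pose t := tensor ((A, B) : V).
have eA i j : A (ord_bool i) (ord_bool j) = t i j false by [].
have eB i j : B (ord_bool i) (ord_bool j) = sign2 i j * t (~~ i) (~~ j) true.
  by rewrite /t /tensor !negbK sign2N sign2K.
have eAB : A *m B^T = 0 <-> forall i i',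
    t i false false * t i' true true = t i true false * t i' false true.
  have entry i j : (A *m B^T) (ord_bool i) (ord_bool j) = sign2 j false *
      (t i false false * t (~~ j) true true - t i true false * t (~~ j) false true).
    rewrite mxE sum_ord_bool !mxE !eA !eB /=.
    by case: j; rewrite /sign2 /=; ring.
  rewrite mx22_eq0; split=> H i j; last first.
    by apply/eqP; rewrite entry mulf_eq0 subr_eq0 H eqxx orbT.
  have /eqP := H i (~~ j).
  by rewrite entry mulf_eq0 (negbTE (sign2_neq0 _ _)) subr_eq0 negbK => /eqP.
have eBA : B^T *m A = 0 <-> forall j j',
    t false j false * t true j' true = t true j false * t false j' true.
  have entry i j : (B^T *m A) (ord_bool i) (ord_bool j) = sign2 i false *
      (t false j false * t true (~~ i) true - t true j false * t false (~~ i) true).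
    rewrite mxE sum_ord_bool !mxE !eA !eB /=.
    by case: i; rewrite /sign2 /=; ring.
  rewrite mx22_eq0; split=> H i j; last first.
    by apply/eqP; rewrite entry mulf_eq0 subr_eq0 H eqxx orbT.
  have /eqP := H (~~ j) i.
  by rewrite entry mulf_eq0 (negbTE (sign2_neq0 _ _)) subr_eq0 negbK => /eqP.
have eA1 : (\rank A <= 1)%N <->
    t false false false * t true true false = t false true false * t true false false.
  exact: rank2_le1.
have eB1 : (\rank B <= 1)%N <->
    t true true true * t false false true = t true false true * t false true true.
  rewrite rank2_le1 (eB false false) (eB true true) (eB false true) (eB true false).
  by rewrite /sign2 /= !mul1r !mulN1r mulrNN.
split=> [[/eAB hAB /eBA hBA /eA1 hA /eB1 hB]|[s1 s2]].
  have h1 i j i' j' : t i j false * t i' j' true = t i' j false * t i j' true.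
    by case: i i' => -[] //; rewrite hBA.
  have h2 i j i' j' : t i j false * t i' j' true = t i j' false * t i' j true.
    by case: j j' => -[] //; rewrite hAB.
  have hA' i j i' j' : t i j false * t i' j' false = t i' j false * t i j' false.
    by case: i i' j j' => -[] -[] -[] //;
      first [by rewrite mulrC | by rewrite hA mulrC | by rewrite mulrC hA
            | by rewrite -hA mulrC].
  have hB' i j i' j' : t i j true * t i' j' true = t i' j true * t i j' true.
    by case: i i' j j' => -[] -[] -[] //;
      first [by rewrite mulrC | by rewrite hB mulrC | by rewrite mulrC hB
            | by rewrite -hB mulrC].
  split=> i j [] i' j' []; rewrite -/t.
  - exact: hB'.
  - by rewrite mulrC h1 mulrC.
  - exact: h1.
  - exact: hA'.
  - by rewrite hB' mulrC.
  - by rewrite mulrC h2 mulrC.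
  - exact: h2.
  - by rewrite hA' mulrC.
split.
- by apply/eAB => i i'; apply: s2.
- by apply/eBA => j j'; apply: s1.
- by apply/eA1; rewrite (s1 false) mulrC.
- by apply/eB1; rewrite (s1 true) mulrC.
Qed.

End TwoByTwo.

(** * Quadrics built from linear forms, and linear forms on spans *)

Section Quadrics.
Variables (K : closedFieldType) (V : vectType K).
Implicit Types (l : V -> K) (v w : V).

Definition quadric l1 l2 l3 l4 : {mpoly K[\dim {:V}]} :=
  linear_form l1 * linear_form l2 - linear_form l3 * linear_form l4.

Lemma quadric_homog l1 l2 l3 l4 : homogeneous (quadric l1 l2 l3 l4).
Proof.
by exists 2; apply: rpredB; apply: (@dhomogM _ _ _ 1 _ 1); apply: linear_form_homog.
Qed.

Lemma quadric_eval l1 l2 l3 l4 v :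
  scalar l1 -> scalar l2 -> scalar l3 -> scalar l4 ->
  (quadric l1 l2 l3 l4).@[coords v] = l1 v * l2 v - l3 v * l4 v.
Proof. by move=> s1 s2 s3 s4; rewrite mevalB !mevalM !linear_form_eval. Qed.

Lemma differential_quadric l1 l2 l3 l4 v w :
  scalar l1 -> scalar l2 -> scalar l3 -> scalar l4 ->
  differential (quadric l1 l2 l3 l4) v w =
  l1 w * l2 v + l1 v * l2 w - (l3 w * l4 v + l3 v * l4 w).
Proof.
move=> s1 s2 s3 s4; rewrite differentialD -scaleN1r differentialZ mulN1r.
by rewrite !differentialM !differential_linear_form // !linear_form_eval.
Qed.

Lemma scalar_vline l v w : scalar l -> l v = 0 -> w \in <[v]>%VS -> l w = 0.
Proof.
move=> linl lv /vlineP[c ->].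
have := @scalar_sum K V l unit (fun=> c) (fun=> v) linl.
by rewrite !big_const !cardT !enumT /= !unlock /= !addr0 lv mulr0.
Qed.

Lemma scalar_addv l v w (U : {vspace V}) : scalar l ->
  (forall u, u \in U -> l u = 0) -> l v = 0 -> w \in (U + <[v]>)%VS -> l w = 0.
Proof.
move=> linl lU lv /memv_addP[u /lU lu [u' /vlineP[c ->] ->]].
by rewrite addrC linl lu lv mulr0 addr0.
Qed.

End Quadrics.

(** * Pure tensors: equations, irreducibility and smoothness of [Xdeg] for [(m, k) = (2, 1)] *)

Section SegreCone.
Variable K : closedFieldType.
Local Notation V := (matrix_pairs K 2).
Local Notation vec := (bool -> K).
Implicit Types (x y z a b c p q r : vec) (v w : V).

Definition bracket p x := p false * x true - p true * x false.

Definition perp p (i : bool) : K := if i then p false else - p true.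

Definition contract (f : vec) := f false + f true.

(** The tensor product of the three forms [bracket p], [bracket q] and [bracket r], each bracket
    being a 2 x 2 determinant. For suitable arguments these are, up to sign, the coordinates in a
    basis of pure tensors. *)
Definition lambda p q r v := contract (fun i => contract (fun j => contract (fun l =>
  perp p i * perp q j * perp r l * tensor v i j l))).

Lemma lambda_linear p q r : scalar (lambda p q r).
Proof. by move=> t v w; rewrite /lambda /contract !tensorD !tensorZ; ring. Qed.

Lemma lambda_tau p q r x y z :
  lambda p q r (tau x y z) = bracket p x * bracket q y * bracket r z.
Proof. by rewrite /lambda /contract !tensor_tau /perp /bracket; ring. Qed.

Lemma bracket_self x : bracket x x = 0.
Proof. by rewrite /bracket; ring. Qed.

Lemma bracketC x y : bracket x y = - bracket y x.
Proof. by rewrite /bracket; ring. Qed.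

(** Cramer's rule in each factor, in the form [bracket x a * u = - bracket a u * x + bracket x u *
    a], multiplied out over the three factors. *)
Lemma tau_expansion x a y b z c v :
  (bracket x a * bracket y b * bracket z c) *: v =
  (- lambda a b c v) *: tau x y z + lambda x b c v *: tau a y z
  + lambda a y c v *: tau x b z + lambda a b z v *: tau x y c
  + (- lambda x y c v) *: tau a b z + (- lambda x b z v) *: tau a y c
  + (- lambda a y z v) *: tau x b c + lambda x y z v *: tau a b c.
Proof.
apply: tensor_inj => i j l; rewrite !tensorD !tensorZ !tensor_tau.
by rewrite /lambda /contract /perp /bracket; case: i; case: j; case: l; ring.
Qed.

Lemma complement x i : x i != 0 -> exists a, bracket x a = 1.
Proof.
case: i => xi.
  exists (fun j => if j then 0 else - (x true)^-1).
  by rewrite /bracket mulr0 sub0r mulrN opprK mulfV.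
exists (fun j => if j then (x false)^-1 else 0).
by rewrite /bracket mulr0 subr0 mulfV.
Qed.

Lemma tau_neq0 x y z : tau x y z != 0 ->
  exists i j l, [/\ x i != 0, y j != 0 & z l != 0].
Proof.
move=> v0; have [[i [j [l /eqP]]]|n] :=
    pselect (exists i j l, tensor (tau x y z) i j l <> 0).
  rewrite tensor_tau !mulf_eq0 !negb_or => /andP[/andP[xi yj] zl].
  by exists i, j, l.
case/eqP: v0; apply: tensor_inj => i j l.
have -> : tensor (0 : V) i j l = 0 by rewrite -(scale0r (0 : V)) tensorZ mul0r.
by apply: contrapT => ne; apply: n; exists i, j, l.
Qed.

Definition segre_quadrics : set {mpoly K[\dim {:V}]} :=
  [set F | exists i j l i' j' l',
    F = quadric (fun v => tensor v i j l) (fun v => tensor v i' j' l')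
          (fun v => tensor v i' j l) (fun v => tensor v i j' l') \/
    F = quadric (fun v => tensor v i j l) (fun v => tensor v i' j' l')
          (fun v => tensor v i j' l) (fun v => tensor v i' j l')].

Lemma segre_quadricsP v :
  (exists x y z, v = tau x y z) <-> forall F, segre_quadrics F -> F.@[coords v] = 0.
Proof.
rewrite -swap_tau; split=> [[s1 s2] F [i [j [l [i' [j' [l' [->|->]]]]]]]|H].
- by rewrite quadric_eval; [rewrite s1 subrr|exact: tensor_linear..].
- by rewrite quadric_eval; [rewrite s2 subrr|exact: tensor_linear..].
split=> i j l i' j' l'; apply/eqP; rewrite -subr_eq0; apply/eqP.
  rewrite -(H _ (ex_intro _ i (ex_intro _ j (ex_intro _ l (ex_intro _ i'
    (ex_intro _ j' (ex_intro _ l' (or_introl erefl)))))))).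
  by rewrite quadric_eval //; exact: tensor_linear.
rewrite -(H _ (ex_intro _ i (ex_intro _ j (ex_intro _ l (ex_intro _ i'
  (ex_intro _ j' (ex_intro _ l' (or_intror erefl)))))))).
by rewrite quadric_eval //; exact: tensor_linear.
Qed.

Lemma segre_quadrics_homog F : segre_quadrics F -> homogeneous F.
Proof. by move=> [i [j [l [i' [j' [l' [->|->]]]]]]]; apply: quadric_homog. Qed.

Lemma Xdeg21_closed : zariski_closed (Xdeg K 2 1).
Proof.
apply: (zariski_closed_projset segre_quadrics_homog) => v.
rewrite -segre_quadricsP; exact: Xdeg_coneP.
Qed.

(** For nonzero [y], the cone over a quadric surface, one copy of the product of two projective
    lines. *)
Definition tau_surface y : set V := [set v | exists x z, v = tau x y z].

Lemma tau_surface_scale y t v : tau_surface y v -> tau_surface y (t *: v).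
Proof.
by move=> [x [z ->]]; rewrite tau_scale; exists (fun i => t * x i), z.
Qed.

(** To the Segre quadrics one adds the linear forms [l2], which make the middle fibres proportional
    to [y]. The proportionality factor is then moved into the first tensor factor. *)
Lemma tau_surface_closed y j : y j != 0 -> zariski_closed (projset (tau_surface y)).
Proof.
move=> yj; pose l2 i l v := tensor v i false l * y true - tensor v i true l * y false.
have l2_lin i l : scalar (l2 i l).
  by move=> t v w; rewrite /l2 !tensorD !tensorZ; ring.
apply: (@zariski_closed_projset _ _ _ [set F | segre_quadrics F \/
  exists i l, F = linear_form (l2 i l)]).
  move=> F [/segre_quadrics_homog//|[i [l ->]]].
  by exists 1%N; apply: linear_form_homog.
move=> v; split=> [[x [z ->]] F [|[i [l ->]]]|H].
- by apply: (segre_quadricsP _).1; exists x, y, z.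
- by rewrite linear_form_eval // /l2 !tensor_tau; ring.
have [x [y' [z e]]] : exists x y z, v = tau x y z.
  by apply/segre_quadricsP => F qF; apply: H; left.
have [->|v0] := eqVneq v 0.
  exists (fun=> 0), (fun=> 0); apply: tensor_inj => i j' l.
  by rewrite -(scale0r (0 : V)) tensorZ tensor_tau !mul0r.
have [i [_ [l [xi _ zl]]]] := tau_neq0 (etrans (congr1 (fun u => u != 0) (esym e)) v0).
have yy' : y' false * y true = y' true * y false.
  have := H _ (or_intror (ex_intro _ i (ex_intro _ l erefl))).
  rewrite linear_form_eval // /l2 e !tensor_tau => /eqP.
  rewrite subr_eq0 => /eqP h; apply: (mulfI (mulf_neq0 xi zl)).
  by transitivity (x i * y' false * z l * y true); [ring|rewrite h; ring].
exists (fun i => y' j / y j * x i), z; rewrite e; apply: tensor_inj => i1 j1 l1.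
rewrite !tensor_tau; have -> : y' j1 = y' j / y j * y j1.
  apply: (mulfI yj); transitivity (y' j * y j1); last by field.
  by case: (j) (j1) => -[]; rewrite 1?mulrC // yy' mulrC.
by ring.
Qed.

(** Both first factors run along the same line from [x] to [x']. Treating the factors one after the
    other brings two pure tensors to a common one, which gives irreducibility. *)
Lemma common_tau1 (F G : {mpoly K[\dim {:V}]}) x y z x' y' z' :
  F.@[coords (tau x y z)] != 0 -> G.@[coords (tau x' y' z')] != 0 ->
  exists p, F.@[coords (tau p y z)] != 0 /\ G.@[coords (tau p y' z')] != 0.
Proof.
move=> Fx Gx'; pose d i := x' i - x i.
have Gx'' : G.@[coords (tau x y' z' + tau d y' z')] != 0.
  rewrite -[tau d _ _]scale1r -tau_line1.
  by rewrite (_ : (fun i => _) = x') //; apply: funext => i; rewrite /d; ring.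
have [t] := line_common (tau d y z) Fx Gx''.
by rewrite -!tau_line1 => ?; exists (fun i => x i + t * d i).
Qed.

Lemma common_tau2 (F G : {mpoly K[\dim {:V}]}) x y z x' y' z' :
  F.@[coords (tau x y z)] != 0 -> G.@[coords (tau x' y' z')] != 0 ->
  exists p, F.@[coords (tau x p z)] != 0 /\ G.@[coords (tau x' p z')] != 0.
Proof.
move=> Fx Gx'; pose d i := y' i - y i.
have Gx'' : G.@[coords (tau x' y z' + tau x' d z')] != 0.
  rewrite -[tau _ d _]scale1r -tau_line2.
  by rewrite (_ : (fun i => _) = y') //; apply: funext => i; rewrite /d; ring.
have [t] := line_common (tau x d z) Fx Gx''.
by rewrite -!tau_line2 => ?; exists (fun i => y i + t * d i).
Qed.

Lemma common_tau3 (F G : {mpoly K[\dim {:V}]}) x y z x' y' z' :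
  F.@[coords (tau x y z)] != 0 -> G.@[coords (tau x' y' z')] != 0 ->
  exists p, F.@[coords (tau x y p)] != 0 /\ G.@[coords (tau x' y' p)] != 0.
Proof.
move=> Fx Gx'; pose d i := z' i - z i.
have Gx'' : G.@[coords (tau x' y' z + tau x' y' d)] != 0.
  rewrite -[tau _ _ d]scale1r -tau_line3.
  by rewrite (_ : (fun i => _) = z') //; apply: funext => i; rewrite /d; ring.
have [t] := line_common (tau x y d) Fx Gx''.
by rewrite -!tau_line3 => ?; exists (fun i => z i + t * d i).
Qed.

Lemma Xdeg21_irreducible x y z : tau x y z != 0 -> zariski_irreducible (Xdeg K 2 1).
Proof.
move=> v0; rewrite XdegE; apply: zariski_irreducible_projset.
  by exists (tau x y z) => //; apply/Xdeg_coneP; exists x, y, z.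
move=> F G v w /Xdeg_coneP[x1 [y1 [z1 ->]]] /Xdeg_coneP[x2 [y2 [z2 ->]]] Fv Gw.
have [p [{}Fv {}Gw]] := common_tau1 Fv Gw.
have [q [{}Fv {}Gw]] := common_tau2 Fv Gw.
have [r [{}Fv {}Gw]] := common_tau3 Fv Gw.
by exists (tau p q r); split=> //; apply/Xdeg_coneP; exists p, q, r.
Qed.

Lemma tau_surface_irreducible x y z : tau x y z != 0 ->
  zariski_irreducible (projset (tau_surface y)).
Proof.
move=> v0; apply: zariski_irreducible_projset.
  by exists (tau x y z) => //; exists x, z.
move=> F G v w [x1 [z1 ->]] [x2 [z2 ->]] Fv Gw.
have [p [{}Fv {}Gw]] := common_tau1 Fv Gw.
have [r [{}Fv {}Gw]] := common_tau3 Fv Gw.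
by exists (tau p y r); split=> //; exists p, r.
Qed.

Lemma projset_proper (S S' : set V) v : (forall t u, S u -> S (t *: u)) ->
  S `<=` S' -> S' v -> ~ S v -> v != 0 -> projset S `<` projset S'.
Proof.
move=> Sc SS' S'v nSv v0; split=> [_ [u /SS' Su <-]|sub]; first by exists u.
by apply/nSv/(projset_pt (u := exist _ v v0) Sc)/sub/mem_projset.
Qed.

Lemma lambda_neq0 p q r v : lambda p q r v != 0 -> v != 0.
Proof.
apply: contraNneq => ->.
rewrite (scalar_vline (lambda_linear p q r) (v := tau p q r)) ?mem0v //.
by rewrite lambda_tau !bracket_self !mul0r.
Qed.

(** * The flag and the tangent space at a pure tensor, with a basis chosen in each factor *)

Section AtPoint.
Variables (x a y b z c : vec).
Hypotheses (xa : bracket x a = 1) (yb : bracket y b = 1) (zc : bracket z c = 1).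

Let ax : bracket a x = -1. Proof. by rewrite bracketC xa. Qed.
Let by_ : bracket b y = -1. Proof. by rewrite bracketC yb. Qed.
Let cz : bracket c z = -1. Proof. by rewrite bracketC zc. Qed.

Let bracketE := (lambda_tau, bracket_self, xa, yb, zc, ax, by_, cz,
  @mul0r K, @mulr0 K, @mul1r K, @mulr1 K, @mulN1r K, @opprK K).

Definition tau_line : {vspace V} := (<[tau x y z]> + <[tau x y c]>)%VS.

Lemma dim_tau_line : \dim tau_line = 2.
Proof.
have v0 : tau x y z != 0.
  by apply: (@lambda_neq0 a b c); rewrite !bracketE ?oppr_eq0 oner_neq0.
rewrite dim_add_line ?dim_vline ?v0 //; apply/negP.
move=> /(scalar_vline (lambda_linear a b z)); rewrite !bracketE => /(_ erefl)/eqP.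
by rewrite oner_eq0.
Qed.

Lemma tau_line_sub v : v \in tau_line -> tau_surface y v.
Proof.
move=> /memv_addP[_ /vlineP[s ->] [_ /vlineP[t ->] ->]].
exists x, (fun i => s * z i + t * c i); apply: tensor_inj => i j l.
by rewrite tensorD !tensorZ !tensor_tau; ring.
Qed.

Lemma Xdeg21_chain u : rep u = tau x y z -> irreducible_chain (Xdeg K 2 1) u 3.
Proof.
move=> uE; have uL : rep u \in tau_line by rewrite uE memvE addvSl.
have v0 : tau x y z != 0 by rewrite -uE rep_neq0.
have [|U [_ UL dimU chU]] := linear_chain uL (i := 1); first by rewrite dim_tau_line.
have {UL dimU} UE : U = tau_line by apply/eqP; rewrite eqEdim UL dimU dim_tau_line.
rewrite UE in chU.
have [_ [j [_ [_ yj _]]]] := tau_neq0 v0.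
have chS : irreducible_chain (projset (tau_surface y)) u 2.
  apply: irreducible_chain_extend chU _ (tau_surface_closed yj) (tau_surface_irreducible v0).
  (* The form [lambda x b c] vanishes on the line but equals 1 at [tau a y z]. *)
  apply: (projset_proper (v := tau a y z)); first exact: vspace_scale.
  - exact: tau_line_sub.
  - by exists a, z.
  - have linl := lambda_linear x b c.
    move=> /(scalar_addv linl (fun u => scalar_vline linl _)).
    by rewrite !bracketE => /(_ erefl erefl)/eqP; rewrite oner_eq0.
  - by apply: (@lambda_neq0 x b c); rewrite !bracketE oner_neq0.
apply: irreducible_chain_extend chS _ Xdeg21_closed (Xdeg21_irreducible v0).
(* Likewise [lambda a y c] vanishes on the surface but equals 1 at [tau x b z]. *)
apply: (projset_proper (S' := @Xdeg_cone K 2 1) (v := tau x b z)); first exact: tau_surface_scale.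
- by move=> _ [x' [z' ->]]; apply/Xdeg_coneP; exists x', y, z'.
- by apply/Xdeg_coneP; exists x, b, z.
- move=> [x' [z' /(congr1 (lambda a y c))/eqP]].
  by rewrite !bracketE oner_eq0.
- by apply: (@lambda_neq0 a y c); rewrite !bracketE oner_neq0.
Qed.

(** The span of the pure tensor itself and of its derivatives in the three factors. *)
Definition tau_tangent : {vspace V} :=
  (<[tau x y z]> + <[tau a y z]> + <[tau x b z]> + <[tau x y c]>)%VS.

Lemma tau_tangent0 l w : scalar l -> l (tau x y z) = 0 -> l (tau a y z) = 0 ->
  l (tau x b z) = 0 -> l (tau x y c) = 0 -> w \in tau_tangent -> l w = 0.
Proof.
move=> linl l1 l2 l3 l4; apply: scalar_addv => // {}w.
by apply: scalar_addv => // {}w; apply: scalar_addv => // {}w; apply: scalar_vline.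
Qed.

Lemma dim_tau_tangent : \dim tau_tangent = 4.
Proof.
have v0 : tau x y z != 0.
  by apply: (@lambda_neq0 a b c); rewrite !bracketE ?oppr_eq0 oner_neq0.
have not_in (U : {vspace V}) (l : V -> K) w :
    (forall u, u \in U -> l u = 0) -> l w = 1 -> w \notin U.
  by move=> lU lw; apply/negP => /lU; rewrite lw => /eqP; rewrite oner_eq0.
rewrite !dim_add_line ?dim_vline ?v0 //.
- apply: (not_in _ (lambda x b c)); last by rewrite !bracketE.
  by move=> u; apply: scalar_vline (lambda_linear _ _ _) _; rewrite !bracketE.
- apply: (not_in _ (lambda a y c)); last by rewrite !bracketE.
  have linl := lambda_linear a y c.
  move=> u; apply: (scalar_addv linl); last by rewrite !bracketE.
  by move=> w; apply: (scalar_vline linl); rewrite !bracketE.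
- apply: (not_in _ (lambda a b z)); last by rewrite !bracketE.
  have linl := lambda_linear a b z.
  move=> u; apply: (scalar_addv linl); last by rewrite !bracketE.
  move=> w; apply: (scalar_addv linl); last by rewrite !bracketE.
  by move=> w'; apply: (scalar_vline linl); rewrite !bracketE.
Qed.

Lemma Xdeg21_tangent u : rep u = tau x y z ->
  is_tangent_space (Xdeg K 2 1) u tau_tangent.
Proof.
move=> uE w; have v0 : tau x y z != 0 by rewrite -uE rep_neq0.
rewrite /is_tangent_space uE; split=> [wT F vanF|Fw].
  have vanish p q r : tau p q r != 0 -> F.@[coords (tau p q r)] = 0.
    move=> p0; apply: (vanishing_form_projset (S := @Xdeg_cone K 2 1)) vanF _ p0.
    by apply/Xdeg_coneP; exists p, q, r.
  apply: tau_tangent0 wT; first exact: linear_differential.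
  - apply: differential_line => // t.
    by rewrite -tau_line1 => /vanish.
  - apply: differential_line => // t; rewrite -tau_line1; exact: vanish.
  - apply: differential_line => // t; rewrite -tau_line2; exact: vanish.
  - apply: differential_line => // t; rewrite -tau_line3; exact: vanish.
(* The quadric [lambda a b c * l2 - l3 * l4] vanishes on all pure tensors. At the point [l2], [l3],
   [l4] are zero and [lambda a b c] is -1, so its differential is [- l2]. Four such quadrics kill
   the coefficients of the basis tensors that differ from [tau x y z] in at least two factors. *)
have kill l2 l3 l4 : scalar l2 -> scalar l3 -> scalar l4 ->
    (forall p q r, lambda a b c (tau p q r) * l2 (tau p q r) =
                   l3 (tau p q r) * l4 (tau p q r)) ->
    l2 (tau x y z) = 0 -> l3 (tau x y z) = 0 -> l4 (tau x y z) = 0 -> l2 w = 0.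
  move=> s2 s3 s4 eq24 v2 v3 v4.
  have : differential (quadric (lambda a b c) l2 l3 l4) (tau x y z) w = 0.
    apply: Fw; split; first exact: quadric_homog.
    move=> p /(projset_rep (@Xdeg_cone_scale _ _ _))/Xdeg_coneP[x' [y' [z' e]]].
    rewrite /vanishes_at e quadric_eval //; last exact: lambda_linear.
    by rewrite eq24 subrr.
  rewrite differential_quadric //; last exact: lambda_linear.
  rewrite v2 v3 v4 !bracketE addr0 subr0 add0r => /eqP.
  by rewrite oppr_eq0 => /eqP.
have l1 : lambda x y c w = 0.
  apply: (kill _ (lambda a y c) (lambda x b c)); rewrite ?bracketE //;
    try exact: lambda_linear.
  by move=> p q r; rewrite !lambda_tau; ring.
have l2 : lambda x b z w = 0.
  apply: (kill _ (lambda a b z) (lambda x b c)); rewrite ?bracketE //;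
    try exact: lambda_linear.
  by move=> p q r; rewrite !lambda_tau; ring.
have l3 : lambda a y z w = 0.
  apply: (kill _ (lambda a b z) (lambda a y c)); rewrite ?bracketE //;
    try exact: lambda_linear.
  by move=> p q r; rewrite !lambda_tau; ring.
have l4 : lambda x y z w = 0.
  apply: (kill _ (lambda a b z) (lambda x y c)); rewrite ?bracketE //;
    try exact: lambda_linear.
  by move=> p q r; rewrite !lambda_tau; ring.
have := tau_expansion x a y b z c w.
rewrite l1 l2 l3 l4 xa yb zc !mul1r scale1r oppr0 !scale0r !addr0 => ->.
by rewrite !memv_add // memvZ // memv_line.
Qed.

End AtPoint.

Lemma Xdeg21_smooth : smooth (Xdeg K 2 1).
Proof.
move=> u /(projset_rep (@Xdeg_cone_scale _ _ _))/Xdeg_coneP[x [y [z uE]]].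
have v0 : tau x y z != 0 by rewrite -uE rep_neq0.
have [i [j [l [/complement[a xa] /complement[b yb] /complement[c zc]]]]] := tau_neq0 v0.
exists 3, (tau_tangent x a y b z c); split.
- split; first by have := Xdeg21_chain xa yb zc uE.
  (* For [m = 2] the general bound [n < m * m] reads [n <= 3]. *)
  by move=> n /Xdeg_chain_lt.
- exact: Xdeg21_tangent.
- exact: dim_tau_tangent.
Qed.

End SegreCone.

(** * Projective equivalence with the Segre embedding *)

Section SegreEquivalence.
Variable K : closedFieldType.
Local Notation V := (matrix_pairs K 2).
Local Notation vec := (bool -> K).
Implicit Types (x y z : vec) (v : V).

Lemma pt_eq (W : vectType K) (u w : nonzero W) (c : K) :
  c != 0 -> val w = c *: val u -> pt u = pt w.
Proof.
by move=> c0 e; apply/(@eqmodP _ (collinear_equiv W)); apply/asboolP; exists c.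
Qed.

Definition index8 (i j l : bool) : 'I_8 :=
  mxtens_index (mxtens_index (ord_bool i, ord_bool j), ord_bool l).

Definition tensor_row v : 'rV[K]_8 := \row_(k < 2 * 2 * 2)
  let: (ij, l) := mxtens_unindex k in let: (i, j) := mxtens_unindex ij in
  tensor v (bool_ord i) (bool_ord j) (bool_ord l).

Lemma tensor_rowE v i j l : tensor_row v 0 (index8 i j l) = tensor v i j l.
Proof. by rewrite mxE !mxtens_indexK !ord_boolK. Qed.

Lemma index8P (k : 'I_8) : exists i j l, k = index8 i j l.
Proof.
case/(@mxtens_indexP (2 * 2) 2): k => ij l; case/(@mxtens_indexP 2 2): ij => i j.
by exists (bool_ord i), (bool_ord j), (bool_ord l); rewrite /index8 !bool_ordK.
Qed.

Lemma row8_inj (s t : 'rV[K]_8) :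
  (forall i j l, s 0 (index8 i j l) = t 0 (index8 i j l)) -> s = t.
Proof. by move=> st; apply/rowP => k; have [i [j [l ->]]] := index8P k. Qed.

Fact tensor_row_linear : linear tensor_row.
Proof.
move=> c v w; apply: row8_inj => i j l.
by rewrite [RHS]mxE [X in _ = X + _]mxE !tensor_rowE tensorD tensorZ.
Qed.

HB.instance Definition _ :=
  GRing.isLinear.Build K V 'rV[K]_8 *:%R tensor_row tensor_row_linear.

Lemma tensor_row_bij : bijective tensor_row.
Proof.
exists (fun s : 'rV[K]_8 => of_tensor (fun i j l => s 0 (index8 i j l))) => [v|s].
  by apply: tensor_inj => i j l; rewrite of_tensorK tensor_rowE.
by apply: row8_inj => i j l; rewrite tensor_rowE of_tensorK.
Qed.

Definition row_vec (s : 'rV[K]_2) : vec := fun i => s 0 (ord_bool i).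
Definition vec_row x : 'rV[K]_2 := \row_i x (bool_ord i).

Lemma vec_rowK x : row_vec (vec_row x) = x.
Proof. by apply: funext => i; rewrite /row_vec mxE ord_boolK. Qed.

Lemma tensor_row_tau (r s t : 'rV[K]_2) :
  tensor_row (tau (row_vec r) (row_vec s) (row_vec t)) = r *t s *t t.
Proof.
apply: row8_inj => i j l; rewrite tensor_rowE tensor_tau.
rewrite [RHS]mxE [X in _ = X * _]mxE !mxtens_indexK /=.
by rewrite !(ord1 (Ordinal _)).
Qed.

(** The coordinate change [tensor_row] takes pure tensors to Kronecker products; the rest is
    bookkeeping of the scalars by which chosen representatives of points differ. *)
Lemma Xdeg21_segre : projectively_equivalent (Xdeg K 2 1) (segre K).
Proof.
exists tensor_row, tensor_row_bij; apply/seteqP; split.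
  move=> _ [u /(projset_rep (@Xdeg_cone_scale _ _ _))/Xdeg_coneP[x [y [z uE]]] <-].
  have v0 : tau x y z != 0 by rewrite -uE rep_neq0.
  have nonzero_row x0 i : x0 i != 0 -> vec_row x0 != 0.
    by apply: contra => /eqP e; rewrite -[x0]vec_rowK e /row_vec mxE.
  have [i [j [l [/nonzero_row nx /nonzero_row ny /nonzero_row nz]]]] := tau_neq0 v0.
  pose mk (s : 'rV[K]_2) (s0 : s != 0) : nonzero 'rV[K]_2 := exist _ s s0.
  exists (pt (mk _ nx), pt (mk _ ny), pt (mk _ nz)) => //.
  have [a a0 /= xE] := rep_pt (mk _ nx); have [b b0 /= yE] := rep_pt (mk _ ny).
  have [c c0 /= zE] := rep_pt (mk _ nz).
  (* The representatives of the three points are [a], [b], [c] times the given vectors, so their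
     Kronecker product carries the factor [a * b * c]. *)
  apply: (@pt_eq _ _ _ (a * b * c)^-1); first by rewrite invr_eq0 !mulf_neq0.
  rewrite /= uE -tensor_row_tau -linearZ; congr tensor_row.
  apply: tensor_inj => i0 j0 l0; rewrite tensorZ !tensor_tau.
  have rowZ d (s : 'rV[K]_2) i1 : row_vec (d *: s) i1 = d * row_vec s i1.
    by rewrite /row_vec mxE.
  by rewrite xE yE zE !rowZ !vec_rowK; field; rewrite a0 b0 c0.
move=> _ [[[px py] pz] _ <-].
pose v := tau (row_vec (rep px)) (row_vec (rep py)) (row_vec (rep pz)).
have v0 : v != 0.
  apply: contraTneq (tens_nonzero (tens_nonzero (rep_neq0 px) (rep_neq0 py)) (rep_neq0 pz)).
  by rewrite -tensor_row_tau -/v => ->; rewrite linear0 eqxx.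
exists (pt (exist _ v v0)).
  by apply: (mem_projset (S := @Xdeg_cone K 2 1)); apply/Xdeg_coneP; do 3 eexists.
have [c c0 /= e] := rep_pt (exist (fun v => v != 0) _ v0).
apply: (@pt_eq _ _ _ c^-1); first by rewrite invr_eq0.
by rewrite /= e linearZ /= scalerA mulVf // scale1r tensor_row_tau.
Qed.

End SegreEquivalence.

Theorem theorem1p3 (R : realType) (m k : nat) (hm : (2 <= m)%N) (hk : (k <= m)%N) :
  (smooth (Xdeg R[i] m k) <-> k = 0%N \/ k = m \/ (m = 2%N /\ k = 1%N)) /\
  linear_space (Xdeg R[i] m 0) /\
  linear_space (Xdeg R[i] m m) /\
  projectively_equivalent (Xdeg R[i] 2 1) (segre R[i]).
Proof.
split; last first.
  split; first by exists (lker (linfun (fst : matrix_pairs R[i] m -> _))); exact: Xdeg0_linear.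
  split; last exact: Xdeg21_segre.
  by exists (lker (linfun (snd : matrix_pairs R[i] m -> _))); exact: Xdegm_linear.
split=> [smX|[->|[->|[-> ->]]]].
- have [->|k0] := posnP k; first by left.
  have [->|km] := eqVneq k m; first by right; left.
  have ltkm : (k < m)%N by rewrite ltn_neqAle km.
  have [lt2m|lem2] := ltnP 2 m; first by have := Xdeg_not_smooth hm lt2m k0 ltkm smX.
  have m2 : m = 2 by apply/eqP; rewrite eqn_leq lem2.
  rewrite m2 ltnS in ltkm.
  by right; right; split=> //; apply/eqP; rewrite eqn_leq ltkm.
- by rewrite Xdeg0_linear; exact: smooth_linear.
- by rewrite Xdegm_linear; exact: smooth_linear.
- exact: Xdeg21_smooth.
Qed.
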